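(* Consider the combinatorial Markovian bandit problem with $M$ users and $N\ge M$ resources, and the MLMR policy with a constant $L$, both described in the context. If $$L \;\ge\; \frac{(50+40M)\,\theta_{\max}^2\, s_{\max}^2}{\epsilon_{\min}},$$ then for every time $n\ge 1$ the expected regret $R(n)$ of the MLMR policy satisfies $$R(n)\;\le\;\left[\frac{4M^3 N L\ln n}{(\Delta_{\min})^2}+MN+M^2N\,\frac{s_{\max}}{\pi_{\min}}\left(1+\frac{\epsilon_{\max}\sqrt{L}}{10\,s_{\min}\theta_{\min}}\right)\frac{\pi^2}{3}\right]\Delta_{\max}+A_{\mathbf S,\mathbf P,\Theta},$$ where in the factor $\pi^2/3$ the symbol $\pi$ is the number $3.14159\ldots$.
   Context: **Model.** There are $M$ users and $N\ge M$ resources; time is slotted, $n=1,2,\dots$. To each pair $(i,j)$, $1\le i\le M$, $1\le j\le N$, is associated an irreducible aperiodic Markov chain with finite state space $S_{i,j}$, transition matrix $\mathbf P_{i,j}$, stationary distribution $(\pi^{i,j}_z)_{z\in S_{i,j}}$ and arbitrary initial distribution. The chains of different pairs are mutually independent. The chain of pair $(i,j)$ makes a transition only at those time slots in which resource $j$ is allocated to user $i$ (rested chains). When user $i$ is allocated resource $j$ and the chain is in state $z$, user $i$ observes and receives the reward $\theta^{i,j}_z>0$. The mean reward is $\mu_{i,j}=\sum_{z\in S_{i,j}}\theta^{i,j}_z\pi^{i,j}_z$. **Arms and policies.** An arm $k$, $1\le k\le P(N,M)=N!/(N-M)!$, is a matching assigning distinct resources to all $M$ users, identified with its set $\mathcal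 A_k$ of $M$ pairs $(i,j)$. A policy $\alpha$ selects, at each time, an arm as a deterministic function of the past choices and of the past rewards observed for each played pair. Playing arm $k$ at time $n$ yields the rewards $Y_{i,j}(n)$ for all $(i,j)\in\mathcal A_k$, with $Y_{i,j}(n)=\theta^{i,j}_z$ for the current state $z$ of chain $(i,j)$, and total reward $\sum_{(i,j)\in\mathcal A_k}Y_{i,j}(n)$. Let $\mu^k=\sum_{(i,j)\in\mathcal A_k}\mu_{i,j}$ and $\mu^*=\max_k\mu^k$. Let $T_k^\alpha(n)$ be the number of times arm $k$ is played in the first $n$ slots under policy $\alpha$. **Regret.** $R^\alpha(n)=n\mu^*-E_\alpha\big[\sum_{t=1}^n Y_{\alpha(t)}(t)\big]$, where $Y_{\alpha(t)}(t)$ is the total reward at time $t$ of the arm chosen by $\alpha$. **MLMR policy.** For every pair keep $n_{i,j}$, the number of times resource $j$ has been allocated to user $i$ so far, and $\hat\theta_{i,j}$, the sample mean of all rewards observed so far for the pair $(i,j)$; both are updated after each slot for all pairs of the played arm. Initialization: during the first $MN$ slots, for each pair $(p,q)$ in turn, one slot is spent playing any arm $k$ with $(p,q)\in\mathcal A_k$. Afterwards, at each time $n=MN+1,MN+2,\dots$, play an arm $k$ that maximizes $$\sum_{(i,j)\in\mathcal A_k}\left(\hat\theta_{i,j}+\sqrt{\frac{L\ln n}{n_{i,j}}}\right),$$ where $\hat\theta_{i,j},n_{i,j}$ are the current values and $L$ is a positive constant. **Constants.** $\Delta_k=\mu^*-\mu^k$; $\Delta_{\min}=\min_{k:\mu^k<\mu^*}\Delta_k$;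 $\Delta_{\max}=\max_k\Delta_k$; $\pi_{\min}=\min_{i,j,\,z\in S_{i,j}}\pi^{i,j}_z$; $s_{\max}=\max_{i,j}|S_{i,j}|$, $s_{\min}=\min_{i,j}|S_{i,j}|$; $\theta_{\max}=\max_{i,j,z}\theta^{i,j}_z$, $\theta_{\min}=\min_{i,j,z}\theta^{i,j}_z$; $\epsilon_{i,j}=1-\lambda_2$, where $\lambda_2$ is the second largest eigenvalue of $\mathbf P_{i,j}$; $\epsilon_{\max}=\max_{i,j}\epsilon_{i,j}$, $\epsilon_{\min}=\min_{i,j}\epsilon_{i,j}$. $A_{\mathbf S,\mathbf P,\Theta}$ is a constant, depending only on the state spaces, transition matrices and rewards of all the pairs, such that $R^\alpha(n)\le\sum_{k=1}^{P(N,M)}(\mu^*-\mu^k)E_\alpha[T_k^\alpha(n)]+A_{\mathbf S,\mathbf P,\Theta}$ for every policy $\alpha$ and every $n$. *)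

(* Defs.v *)
From mathcomp Require Export all_boot all_order all_algebra.
From mathcomp Require Export complex.
From mathcomp Require Export all_classical all_reals all_analysis.

#[global] Set Implicit Arguments.
#[global] Unset Strict Implicit.
#[global] Unset Printing Implicit Defensive.
Import Order.TTheory GRing.Theory Num.Theory.

Local Open Scope classical_set_scope.
Local Open Scope ring_scope.

Section FiniteMarkovChain.
Variables (R : realType) (m : nat).
Implicit Types (P : 'M[R]_m) (p : 'rV[R]_m).

Definition is_distribution p :=
  (forall z, 0 <= p 0 z) /\ \sum_(z < m) p 0 z = 1.

Definition stochastic P := forall x, is_distribution (row x P).

Definition irreducible_chain P := forall x y, exists k, 0 < (P ^+ k) x y.

(* Every state has period 1: the only common divisor of its return times is 1. *)
Definition aperiodic_chain P := forall x (c : nat),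
  (forall k, (0 < k)%N -> 0 < (P ^+ k) x x -> (c %| k)%N) -> c = 1%N.

Definition stationary_distribution P p := is_distribution p /\ p *m P = p.

(* The complex eigenvalues, repeated according to algebraic multiplicity. *)
Definition eigenvalues P : seq R[i] :=
  sval (closed_field_poly_normal (char_poly (map_mx (real_complex R) P))).

(* No reversibility is assumed, so eigenvalues may be non-real: they are ranked
   by real part, which is the usual order when the spectrum is real.  For a
   one-state chain there is no second eigenvalue and nth returns 0. *)
Definition lambda2 P : R :=
  nth 0 (sort (fun a b : R => b <= a) [seq complex.Re z | z <- eigenvalues P]) 1.

Definition eigengap P : R := 1 - lambda2 P.

End FiniteMarkovChain.

Section Arms.
Variables M N : nat.

Definition arm := {f : {ffun 'I_M -> 'I_N} | injectiveb f}.

Definition resource (a : arm) : 'I_M -> 'I_N := val a.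

End Arms.
Coercion resource : arm >-> Funclass.

Section Policies.
Variables (R : realType) (M N : nat).

(* What is recorded in one slot: the arm played and, for each user i, the
   reward of the pair (i, a i). *)
Definition slot : Type := (arm M N * {ffun 'I_M -> R})%type.

(* Slots in chronological order; at time n the history has n - 1 elements. *)
Definition history : Type := seq slot.

Definition policy : Type := history -> arm M N.

Implicit Types (h : history) (i : 'I_M) (j : 'I_N).

Definition plays h i j : nat := count (fun o : slot => o.1 i == j) h.

Definition sample_mean h i j : R :=
  (\sum_(o <- h | o.1 i == j) o.2 i) / (plays h i j)%:R.

Definition arm_plays h (a : arm M N) : nat :=
  count (fun o : slot => o.1 == a) h.

Definition total_reward h : R := \sum_(o <- h) \sum_(i < M) o.2 i.

(* The current time is (size h).+1. *)
Definition mlmr_index (L : R) h (a : arm M N) : R :=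
  \sum_(i < M) (sample_mean h i (a i) +
    Num.sqrt (L * ln (size h).+1%:R / (plays h i (a i))%:R)).

(* The order in which the pairs are visited during the initialization and all
   the choices left open (which arm through a given pair, which maximizer) are
   arbitrary. *)
Definition is_MLMR (L : R) (alpha : policy) :=
  (exists e : 'I_(M * N) -> 'I_M * 'I_N, bijective e /\
     forall h (t : 'I_(M * N)), size h = t -> alpha h (e t).1 = (e t).2) /\
  (forall h, (M * N <= size h)%N ->
     forall a, mlmr_index L h a <= mlmr_index L h (alpha h)).

End Policies.

Section Model.
Variables (R : realType) (M N : nat) (s : 'I_M -> 'I_N -> nat).
(* The state space of the pair (i, j) is 'I_(s i j). *)
Variables (P : forall i j, 'M[R]_(s i j)) (stat : forall i j, 'rV[R]_(s i j)).
Variable theta : forall i j, 'I_(s i j) -> R.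

(* As the chains are rested, x i j k is the state of the chain (i, j) when
   resource j is allocated to user i for the (k + 1)-th time. *)
Fixpoint run (alpha : policy R M N) (x : forall i j, nat -> 'I_(s i j))
    (n : nat) : history R M N :=
  if n is t.+1 then
    let h := run alpha x t in
    let a := alpha h in
    rcons h (a, [ffun i => theta (x i (a i) (plays h i (a i)))])
  else [::].

Definition pair_mean i j : R := \sum_(z < s i j) theta z * stat i j 0 z.

Definition arm_mean (a : arm M N) : R := \sum_(i < M) pair_mean i (a i).

(* Below, sup and inf are taken over finite sets, hence are max and min. *)
Definition mu_star : R := sup (range arm_mean).

Definition gap (a : arm M N) : R := mu_star - arm_mean a.

Definition gap_min : R := inf (gap @` [set a | arm_mean a < mu_star]).

Definition gap_max : R := sup (range gap).

Definition theta_max : R := sup [set r | exists i j z, r = @theta i j z].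

Definition theta_min : R := inf [set r | exists i j z, r = @theta i j z].

Definition stat_min : R := inf [set r | exists i j z, r = stat i j 0 z].

Definition s_max : R := sup [set r | exists i j, r = (s i j)%:R].

Definition s_min : R := inf [set r | exists i j, r = (s i j)%:R].

Definition eps_max : R := sup [set r | exists i j, r = eigengap (P i j)].

Definition eps_min : R := inf [set r | exists i j, r = eigengap (P i j)].

Section Probability.
Context (d : measure_display) (T : measurableType d) (Pr : probability T R).
Variable X : forall i j, nat -> T -> 'I_(s i j).

Definition path_event i j (m : nat) (x : nat -> 'I_(s i j)) : set T :=
  [set w | forall k, (k <= m)%N -> X i j k w = x k].

Definition is_markov_chain i j :=
  (forall k z, measurable [set w | X i j k w = z]) /\
  forall m (x : nat -> 'I_(s i j)),
    Pr (path_event m x) =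
    (Pr (path_event 0 x) * (\prod_(k < m) P i j (x k) (x k.+1))%:E)%E.

(* Path events of a chain generate its sigma-algebra.  The product rule for
   subfamilies follows by summing over the values of the omitted chains. *)
Definition chains_independent :=
  forall (m : 'I_M -> 'I_N -> nat) (x : forall i j, nat -> 'I_(s i j)),
    Pr [set w | forall i j, path_event (m i j) (x i j) w] =
    (\prod_(i < M) \prod_(j < N) Pr (path_event (m i j) (x i j)))%E.

Definition rested_chains :=
  (forall i j, is_markov_chain i j) /\ chains_independent.

Definition run_at (alpha : policy R M N) (n : nat) (w : T) : history R M N :=
  run alpha (fun i j k => X i j k w) n.

Definition regret (alpha : policy R M N) (n : nat) : R :=
  n%:R * mu_star -
  fine ('E_Pr[fun w => total_reward (run_at alpha n w)])%E.

Definition expected_plays (alpha : policy R M N) (n : nat) (a : arm M N) : R :=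
  fine ('E_Pr[fun w => (arm_plays (run_at alpha n w) a)%:R])%E.

End Probability.

(* A may depend on the state spaces, transition matrices and rewards only, so
   the inequality is required for all initial distributions of the chains. *)
Definition regret_constant (A : R) :=
  forall (d : measure_display) (T : measurableType d) (Pr : probability T R)
    (X : forall i j, nat -> T -> 'I_(s i j)), rested_chains Pr X ->
  forall (alpha : policy R M N) (n : nat), (0 < n)%N ->
    regret Pr X alpha n <=
    \sum_(a : arm M N) gap a * expected_plays Pr X alpha n a + A.

End Model.

(* Main.v *)
(** Each pair's empirical mean is controlled without reversibility.  The Poisson
    equation [g - P g = f - mu] is solved with the fundamental matrix
    [Z = (1 - P + 1 pi)^-1]; since every column of [Z] is maximal on the diagonal,
    the oscillation of [g] is at most [max f * (tr Z - 1)], and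
    [tr Z - 1 = sum_(k >= 2) 1 / (1 - lambda_k) <= s / eps] (Kemeny's constant).
    As [P (1 + l g) = 1 + l g - l (f - mu)], the function [1 + l g] is an approximate
    eigenvector of [e^(l (f - mu)) P], which yields a Chernoff bound whose variance
    term is [max f ^ 2 * s / eps]; the assumption on [L] turns it into a tail
    [3 / t ^ 5].

    When all confidence intervals at time [t] are correct, a suboptimal arm is only
    played if one of its pairs has been played fewer than
    [4 M^2 L ln n / gap_min^2] times; charging the slot to that pair bounds the number
    of such slots, and the remaining slots are summed through the tail bound. *)
Require Import Defs.
From mathcomp Require Import spectral measurable_realfun.
From mathcomp Require Import ring lra.
Import Order.TTheory GRing.Theory Num.Theory.
Local Open Scope classical_set_scope.
Local Open Scope ring_scope.

(** * Trace of the inverse of a deflated matrix *)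

Lemma mulmx_trig_diag (F : nzRingType) n (A B : 'M[F]_n) i :
  is_trig_mx A -> is_trig_mx B -> (A *m B) i i = A i i * B i i.
Proof.
move=> /is_trig_mxP tA /is_trig_mxP tB.
rewrite mxE (bigD1 i) //= big1 ?addr0 // => k ki.
have [ik|ik] := ltnP i k; first by rewrite tA ?mul0r.
by rewrite tB ?mulr0 // ltn_neqAle ik andbT.
Qed.

(** Forward substitution. The determinant makes the diagonal of [U] nonzero; above the diagonal,
    entry [(i, j)] of [U *m W] reduces to [U i i * W i j], since the earlier rows of [W] already
    vanish in column [j]. *)
Lemma trig_mx_right_inv (F : fieldType) n (U W : 'M[F]_n) :
  is_trig_mx U -> U *m W = 1%:M -> is_trig_mx W.
Proof.
move=> tU UW; have tU' := is_trig_mxP tU.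
have Ui0 i : U i i != 0.
  have : \det U * \det W = 1 by rewrite -det_mulmx UW det1.
  rewrite (det_trig tU) => /eqP h; apply/eqP => Uii.
  by move: h; rewrite (bigD1 i) //= Uii !mul0r eq_sym oner_eq0.
apply/is_trig_mxP => i; have [m] := ubnP (i : nat); elim: m i => // m IH i im j ij.
have := congr1 (fun A : matrix _ _ _ => A i j) UW.
rewrite !mxE (bigD1 i) //= big1 ?addr0.
  by rewrite -val_eqE ltn_eqF // => /eqP; rewrite mulf_eq0 (negPf (Ui0 i)) => /eqP.
move=> k ki; have [ik|ik] := ltnP i k; first by rewrite tU' ?mul0r.
have ki' : (k < i)%N by rewrite ltn_neqAle ik andbT.
rewrite IH ?mulr0 //; first exact: leq_trans ki' _.
exact: ltn_trans ki' ij.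
Qed.

Lemma char_poly_conj (F : fieldType) n (V A : 'M[F]_n) :
  V \in unitmx -> char_poly (V *m A *m invmx V) = char_poly A.
Proof.
move=> uV; rewrite /char_poly.
have -> : char_poly_mx (V *m A *m invmx V) =
  map_mx polyC V *m char_poly_mx A *m map_mx polyC (invmx V).
  rewrite /char_poly_mx !map_mxM /= mulmxBr mulmxBl; congr (_ - _).
  by rewrite scalar_mxC -mulmxA -map_mxM mulmxV // map_mx1 mulmx1.
rewrite !det_mulmx mulrC mulrA -det_mulmx -map_mxM mulVmx //.
by rewrite map_mx1 det1 mul1r.
Qed.

(* P and the projection J are put in triangular form in the same basis; the
   single nonzero diagonal entry of J then marks the eigenvalue of P that the
   deflation [1 - P + J] moves away from [0]. *)
Lemma deflated_inverse_trace (C : numClosedFieldType) n (P J Z : 'M[C]_n) :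
  P *m J = J -> J *m P = J -> J *m J = J -> \tr J = 1 ->
  (1%:M - P + J) *m Z = 1%:M ->
  exists (i0 : 'I_n) (p : 'I_n -> C),
    [/\ char_poly P = \prod_i ('X - (p i)%:P), p i0 = 1,
        forall i, i != i0 -> p i != 1 &
        \tr Z = 1 + \sum_(i | i != i0) (1 - p i)^-1].
Proof.
move=> PJ JP JJ trJ BZ.
have [V uV /andP[]] := cotrigonalization2 (etrans PJ (esym JP)).
have {}uV := unitarymx_unit uV.
rewrite /similar_to !conjumx //.
set cj := fun A : 'M[C]_n => V *m A *m invmx V.
rewrite -/(cj P) -/(cj J) => tP tJ.
have cjM A B : cj (A *m B) = cj A *m cj B.
  by rewrite /cj !mulmxA mulmxKV.
have cj1 : cj 1%:M = 1%:M by rewrite /cj mulmx1 mulmxV.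
have cjB : cj (1%:M - P + J) = 1%:M - cj P + cj J.
  by rewrite /cj mulmxDr mulmxDl mulmxBr mulmxBl -/(cj 1%:M) cj1.
have trcj A : \tr (cj A) = \tr A by rewrite /cj mxtrace_mulC mulmxA mulVmx // mul1mx.
have tB : is_trig_mx (cj (1%:M - P + J)).
  rewrite cjB; apply/is_trig_mxP => i j ij.
  have := is_trig_mxP tP i j ij; have := is_trig_mxP tJ i j ij.
  move: (cj P) (cj J) => P' J' Ji Pi; rewrite !mxE Ji Pi.
  by rewrite -val_eqE ltn_eqF //= subrr addr0.
have BZ' : cj (1%:M - P + J) *m cj Z = 1%:M by rewrite -cjM BZ cj1.
have tZ := trig_mx_right_inv tB BZ'.
(* Diagonal entries of triangular matrices multiply. So [J *m J = J] makes each [q i] equal to 0 or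
   1, and [P *m J = J] gives [p i = 1] wherever [q i = 1]; trace 1 leaves exactly one such index. *)
pose p i : C := cj P i i; pose q i : C := cj J i i.
have q01 i : q i * q i = q i by rewrite /q -mulmx_trig_diag // -cjM JJ.
have pq i : p i * q i = q i by rewrite /p /q -mulmx_trig_diag // -cjM PJ.
have Zi i : (1 - p i + q i) * cj Z i i = 1.
  have := congr1 (fun A : matrix _ _ _ => A i i) BZ'.
  rewrite [X in _ = X]mxE eqxx mulmx_trig_diag // => e; apply: etrans e.
  rewrite cjB /p /q; congr (_ * _).
  by move: (cj P) (cj J) => P' J'; rewrite !mxE eqxx.
have sq : \sum_i q i = 1 by rewrite -trJ -trcj.
have [i0 qi0|q0] := pickP (fun i => q i != 0); last first.
  move: sq; rewrite big1 => [/eqP|i _]; first by rewrite eq_sym oner_eq0.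
  by apply/eqP; move: (q0 i) => /negbFE.
have q1 : q i0 = 1 by apply: (mulfI qi0); rewrite q01 mulr1.
have q0 i : i != i0 -> q i = 0.
  have q_ge0 k : 0 <= q k.
    have [->|qk] := eqVneq (q k) 0; first by [].
    by have -> : q k = 1 by apply: (mulfI qk); rewrite q01 mulr1.
  move: sq; rewrite (bigD1 i0) //= q1 => /eqP.
  rewrite -subr_eq0 addrAC subrr add0r => /eqP/psumr_eq0P h ii0.
  by apply: h.
have p1 : p i0 = 1 by have := pq i0; rewrite q1 mulr1.
exists i0, p; split => //.
- by rewrite -(char_poly_conj P uV) -/(cj P) (char_poly_trig tP).
(* A second eigenvalue 1 would put a zero on the diagonal of the invertible triangular matrix. *)
- move=> i ii0; apply/eqP => pi1; have := Zi i.
  by rewrite pi1 q0 // subrr addr0 mul0r => /eqP; rewrite eq_sym oner_eq0.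
- rewrite -(trcj Z) /mxtrace (bigD1 i0) //=; congr (_ + _).
    by have := Zi i0; rewrite p1 q1 subrr add0r mul1r.
  apply: eq_bigr => i ii0; have := Zi i; rewrite q0 // addr0 => h.
  have h0 : 1 - p i != 0.
    by apply/eqP => e; move: h; rewrite e mul0r => /eqP; rewrite eq_sym oner_eq0.
  by apply: (mulfI h0); rewrite h divff.
Qed.

(** * Fundamental matrix of an irreducible chain *)

Section MarkovChain.
Variables (R : realType) (n : nat) (P : 'M[R]_n).
Hypothesis stoP : stochastic P.

Lemma stochastic_ge0 x y : 0 <= P x y.
Proof. by have [/(_ y)] := stoP x; rewrite mxE. Qed.

Lemma stochastic_sum x : \sum_y P x y = 1.
Proof. by have [_ <-] := stoP x; apply: eq_bigr => y _; rewrite mxE. Qed.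

Lemma stochastic_mul1 : P *m const_mx 1 = const_mx 1 :> 'cV_n.
Proof.
apply/matrixP => x k; rewrite !mxE -[RHS](stochastic_sum x).
by apply: eq_bigr => y _; rewrite mxE mulr1.
Qed.

Lemma mulmx_pow_fixed (v : 'cV[R]_n) k : P *m v = v -> (P ^+ k) *m v = v.
Proof.
move=> Pv; elim: k => [|k IH]; first by rewrite expr0 mul1mx.
by rewrite exprS -mulmxA IH.
Qed.

Lemma pow_mulmx_fixed (p : 'rV[R]_n) k : p *m P = p -> p *m (P ^+ k) = p.
Proof.
move=> pP; elim: k => [|k IH]; first by rewrite expr0 mulmx1.
by rewrite exprS mulmxA pP.
Qed.

Lemma stochastic_pow_ge0 k x y : 0 <= (P ^+ k) x y.
Proof.
elim: k x => [|k IH] x; first by rewrite expr0 mxE ler0n.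
rewrite exprS mxE; apply: sumr_ge0 => z _.
by rewrite mulr_ge0 ?stochastic_ge0.
Qed.

Lemma stochastic_pow_sum k x : \sum_y (P ^+ k) x y = 1.
Proof.
have := mulmx_pow_fixed k stochastic_mul1.
move=> /(congr1 (fun A : 'cV[R]_n => A x 0)); rewrite !mxE => <-.
by apply: eq_bigr => y _; rewrite mxE mulr1.
Qed.

(** For a left eigenvector [v], the l1 norm of [v P] is at most that of [v], because the rows of [P]
    are nonnegative with sum 1. *)
Lemma stochastic_eigenvalue_norm (a : R[i]) :
  root (char_poly (map_mx (real_complex R) P)) a -> `|a| <= 1.
Proof.
rewrite -eigenvalue_root_char => /eigenvalueP[v vP v0].
have Nv : 0 < \sum_x `|v 0 x|.
  rewrite lt_def sumr_ge0 ?andbT => [|? _]; last exact: normr_ge0.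
  apply: contraNneq v0 => h; apply/eqP/rowP => x; rewrite mxE; apply/eqP.
  rewrite -normr_eq0; apply/eqP.
  by move: h => /psumr_eq0P -> // ? _; exact: normr_ge0.
rewrite -(ler_pM2r Nv) mul1r mulr_sumr.
have -> : \sum_y `|a| * `|v 0 y| =
    \sum_y `|\sum_x v 0 x * (real_complex R) (P x y)|.
  apply: eq_bigr => y _; rewrite -normrM.
  have := congr1 (fun A : 'rV[R[i]]_n => A 0 y) vP; rewrite !mxE => <-.
  by congr (`| _ |); apply: eq_bigr => x _; rewrite mxE.
apply: (@le_trans _ _ (\sum_y \sum_x `|v 0 x| * (real_complex R) (P x y))).
  apply: ler_sum => y _; apply: le_trans (ler_norm_sum _ _ _) _.
  apply: ler_sum => x _; rewrite normrM ler_wpM2l //.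
  by rewrite ger0_norm // ler0c stochastic_ge0.
rewrite exchange_big /=; apply: ler_sum => x _.
by rewrite -mulr_sumr -rmorph_sum stochastic_sum rmorph1 mulr1.
Qed.

Hypothesis irrP : irreducible_chain P.
Variable p : 'rV[R]_n.
Hypothesis statp : stationary_distribution P p.

(** Some state [y] carries mass; by irreducibility a power of [P] moves part of it to [x], and [p]
    is invariant under that power. *)
Lemma stationary_gt0 x : 0 < p 0 x.
Proof.
have [[p0 p1] pP] := statp.
have [y py|np] := pickP (fun y => 0 < p 0 y); last first.
  have : \sum_z p 0 z <= 0 by apply: sumr_le0 => z _; rewrite leNgt np.
  by rewrite p1 ler10.
have [k Pk] := irrP y x.
have := congr1 (fun A : 'rV[R]_n => A 0 x) (pow_mulmx_fixed k pP).
rewrite mxE => <-; rewrite (bigD1 y) //= ltr_wpDr ?mulr_gt0 //.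
by apply: sumr_ge0 => z _; rewrite mulr_ge0 ?stochastic_pow_ge0.
Qed.

(** Maximum principle: at a maximizer [m], [v m 0] is a [P ^+ k]-average of values that do not
    exceed it, so every state reached with positive weight attains the maximum too. *)
Lemma harmonic_const (v : 'cV[R]_n) : P *m v = v -> forall x y, v x 0 = v y 0.
Proof.
move=> Pv x0 y0.
pose m := [arg max_(i > x0) v i 0]%O.
have vm z : v z 0 <= v m 0 by rewrite /m; case: arg_maxP => // i _ /(_ z isT).
suff e z : v z 0 = v m 0 by rewrite !e.
have [k Pk] := irrP m z.
have h : \sum_y (P ^+ k) m y * (v m 0 - v y 0) = 0.
  transitivity (\sum_y ((P ^+ k) m y * v m 0 - (P ^+ k) m y * v y 0)).
    by apply: eq_bigr => y _; rewrite mulrBr.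
  rewrite sumrB -mulr_suml stochastic_pow_sum mul1r.
  have := congr1 (fun A : 'cV[R]_n => A m 0) (mulmx_pow_fixed k Pv).
  by rewrite mxE => ->; rewrite subrr.
move: h => /psumr_eq0P h; apply/eqP; rewrite eq_sym -subr_eq0.
have /eqP := h (fun y _ => mulr_ge0 (stochastic_pow_ge0 k m y)
  (etrans (subr_ge0 _ _) (vm y))) z isT.
by rewrite mulf_eq0 gt_eqF.
Qed.

(** The rank-one projection onto constant vectors; all its rows equal [p]. It repairs the kernel of
    [1 - P]. *)
Definition deflation : 'M[R]_n := const_mx 1 *m p.

Lemma deflationE x y : deflation x y = p 0 y.
Proof. by rewrite /deflation !mxE big_ord1 mxE mul1r. Qed.

Let pP : p *m P = p := proj2 statp.

Lemma stationary_mul1 : p *m (const_mx 1 : 'cV_n) = 1%:M.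
Proof.
apply/matrixP => i j; rewrite !ord1 !mxE eqxx -[RHS](proj2 (proj1 statp)).
by apply: eq_bigr => y _; rewrite mxE mulr1.
Qed.

Lemma mulmx_deflation : P *m deflation = deflation.
Proof. by rewrite /deflation mulmxA stochastic_mul1. Qed.

Lemma deflation_mulmx : deflation *m P = deflation.
Proof. by rewrite /deflation -mulmxA pP. Qed.

Lemma deflation_idem : deflation *m deflation = deflation.
Proof. by rewrite /deflation mulmxA -(mulmxA _ p) stationary_mul1 mulmx1. Qed.

Lemma deflation_trace : \tr deflation = 1.
Proof.
rewrite /deflation mxtrace_mulC stationary_mul1 mxtrace1.
by [].
Qed.

(** If [v] is in the kernel, multiplying by [p] on the left gives [p v = 0]. Then [P v = v], so [v]
    is constant, and [p v = 0] forces it to vanish. *)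
Lemma deflated_unit : 1%:M - P + deflation \in unitmx.
Proof.
(* [det0P] yields a row vector killed from the left; transposing turns it into a column vector. *)
rewrite unitmxE unitfE -det_tr; apply/det0P => -[w w0 /(congr1 trmx)].
rewrite trmx_mul trmxK trmx0; set v := w^T => Bv.
have pv : p *m v = 0.
  have := congr1 (mulmx p) Bv; rewrite mulmx0 mulmxA mulmxDr mulmxBr mulmx1 pP.
  by rewrite subrr add0r /deflation mulmxA stationary_mul1 mul1mx.
have Pv : P *m v = v.
  move: Bv; rewrite mulmxDl mulmxBl mul1mx /deflation -(mulmxA _ p) pv mulmx0 addr0.
  by move=> /eqP; rewrite subr_eq0 => /eqP.
case/negP: w0; apply/eqP/rowP => x; rewrite mxE.
have vx y : v y 0 = v x 0 by exact: harmonic_const.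
have : (p *m v) 0 0 = w 0 x.
  rewrite mxE; transitivity (\sum_y p 0 y * v x 0).
    by apply: eq_bigr => y _; rewrite vx.
  by rewrite -mulr_suml (proj2 (proj1 statp)) mul1r mxE.
by rewrite pv mxE.
Qed.

Definition fundamental : 'M[R]_n := invmx (1%:M - P + deflation).

Lemma deflated_mul1 : (1%:M - P + deflation) *m (const_mx 1 : 'cV_n) = const_mx 1.
Proof.
rewrite mulmxDl mulmxBl mul1mx stochastic_mul1 subrr add0r.
by rewrite /deflation -mulmxA stationary_mul1 mulmx1.
Qed.

Lemma fundamental_sum x : \sum_y fundamental x y = 1.
Proof.
have := congr1 (mulmx fundamental) deflated_mul1.
rewrite mulKmx ?deflated_unit // => /(congr1 (fun A : 'cV[R]_n => A x 0)).
rewrite [X in X = _]mxE mxE => ->.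
by apply: eq_bigr => y _; rewrite [X in _ * X]mxE mulr1.
Qed.

Lemma fundamental_poisson : fundamental - P *m fundamental = 1%:M - deflation.
Proof.
have pZ : p *m fundamental = p.
  have pB : p *m (1%:M - P + deflation) = p.
    rewrite mulmxDr mulmxBr mulmx1 pP subrr add0r.
    by rewrite /deflation mulmxA stationary_mul1 mul1mx.
  by rewrite -[X in X *m _]pB mulmxK ?deflated_unit.
have := mulmxV deflated_unit; rewrite -/fundamental mulmxDl mulmxBl mul1mx.
rewrite {2}/deflation -mulmxA pZ -/deflation => <-.
by rewrite addrK.
Qed.

Lemma fundamental_poissonE x z :
  fundamental x z = \sum_y P x y * fundamental y z + (x == z)%:R - p 0 z.
Proof.
have := congr1 (fun A : 'M[R]_n => A x z) fundamental_poisson.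
move/eqP; rewrite mxE [in X in _ + X]mxE [X in _ - X]mxE.
rewrite [X in _ == X]mxE [in X in _ == X + _]mxE [in X in _ == _ + X]mxE deflationE.
by rewrite subr_eq => /eqP ->; rewrite addrC addrA.
Qed.

(* Off its diagonal entry, column z is strictly below its own P-average, so it
   cannot be maximal there. *)
Lemma fundamental_diag_max x z : fundamental x z <= fundamental z z.
Proof.
pose m := [arg max_(i > x) fundamental i z]%O.
have vm y : fundamental y z <= fundamental m z.
  by rewrite /m; case: arg_maxP => // i _ /(_ y isT).
have [e|mz] := eqVneq m z; first by rewrite -[X in _ <= fundamental X z]e.
have := fundamental_poissonE m z; rewrite (negPf mz) addr0 => /eqP.
rewrite -subr_eq0 => /eqP e.
have : \sum_y P m y * fundamental y z <= fundamental m z.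
  rewrite -[leRHS]mul1r -(stochastic_sum m) mulr_suml.
  by apply: ler_sum => y _; rewrite ler_wpM2l ?stochastic_ge0.
have := stationary_gt0 z; move: e; lra.
Qed.

(** Row [y] sums to 1, so the trace minus 1 is the sum of [Z z z - Z y z], with [Z] the fundamental
    matrix. These terms are nonnegative and dominate [Z x z - Z y z] by diagonal maximality. *)
Lemma fundamental_osc (f : 'I_n -> R) F x y :
  (forall z, 0 <= f z <= F) ->
  \sum_z (fundamental x z - fundamental y z) * f z <= F * (\tr fundamental - 1).
Proof.
move=> f0F.
rewrite -(fundamental_sum y) /mxtrace -sumrB mulr_sumr.
apply: ler_sum => z _; have /andP[f0 fF] := f0F z.
have h := fundamental_diag_max x z; have h' := fundamental_diag_max y z.
nra.
Qed.

End MarkovChain.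

(** * Spectral gap and the Poisson equation *)

Lemma Re_le_norm (R : rcfType) (z : R[i]) (r : R) :
  `|z| <= real_complex R r -> complex.Re z <= r.
Proof.
move=> h; have := le_trans (normc_ge_Re z) h; rewrite lecR.
exact: le_trans (ler_norm _).
Qed.

Lemma Re_lt1 (R : rcfType) (z : R[i]) : `|z| <= 1 -> z != 1 -> complex.Re z < 1.
Proof.
move=> z1 zn; rewrite lt_def; have -> : complex.Re z <= 1 by exact: Re_le_norm.
rewrite andbT; apply: contraNneq zn => e.
have : `|z| ^+ 2 <= 1 by rewrite exprn_ile1.
rewrite -add_Re2_Im2 -e (_ : 1 = real_complex R 1) // lecR expr1n gerDl => h.
have /eqP : complex.Im z ^+ 2 = 0 by apply/eqP; rewrite eq_le h sqr_ge0.
rewrite sqrf_eq0 => /eqP i0; apply/eqP; case: z e i0 {z1 h} => a b /= <- ->.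
by [].
Qed.

Lemma Re_inv_le (R : rcfType) (z : R[i]) (e : R) :
  0 < e -> e <= complex.Re z -> complex.Re z^-1 <= e^-1.
Proof.
case: z => a b /= e0 ea.
have a0 : 0 < a by exact: lt_le_trans ea.
have h : 0 < a ^+ 2 + b ^+ 2 by rewrite ltr_wpDr ?sqr_ge0 ?exprn_gt0.
rewrite ler_pdivrMr // ler_pdivlMl //.
have := sqr_ge0 b; nra.
Qed.

Section Gap.
Variables (R : realType) (n : nat) (P : 'M[R]_n) (p : 'rV[R]_n).
Hypotheses (stoP : stochastic P) (irrP : irreducible_chain P).
Hypothesis statp : stationary_distribution P p.

Let Pc := map_mx (real_complex R) P.

Let spec : exists (i0 : 'I_n) (q : 'I_n -> R[i]),
    [/\ char_poly Pc = \prod_i ('X - (q i)%:P), q i0 = 1,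
        forall i, i != i0 -> q i != 1 &
        real_complex R (\tr (fundamental P p)) = 1 + \sum_(i | i != i0) (1 - q i)^-1].
Proof.
have [] := @deflated_inverse_trace R[i] n Pc (map_mx (real_complex R) (deflation p))
  (map_mx (real_complex R) (fundamental P p)).
- by rewrite -map_mxM mulmx_deflation.
- by rewrite -map_mxM (deflation_mulmx statp).
- by rewrite -map_mxM (deflation_idem statp).
- by rewrite trace_map_mx (deflation_trace statp) rmorph1.
- rewrite -(map_mx1 (real_complex R)) -map_mxB -map_mxD -map_mxM.
  by rewrite mulmxV ?(deflated_unit stoP).
by move=> i0 [q [h1 h2 h3 h4]]; exists i0, q; split; rewrite -?trace_map_mx.
Qed.

Let eigenvalue_norm i0 (q : 'I_n -> R[i]) :
  char_poly Pc = \prod_i ('X - (q i)%:P) -> `|q i0| <= 1.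
Proof.
move=> h; apply: (stochastic_eigenvalue_norm stoP); rewrite -/Pc h.
by rewrite (bigD1 i0) //= rootM root_XsubC eqxx.
Qed.

Lemma perm_eigenvalues (q : 'I_n -> R[i]) :
  char_poly Pc = \prod_i ('X - (q i)%:P) ->
  perm_eq (eigenvalues P) [seq q i | i <- enum 'I_n].
Proof.
move=> h; apply: prod_XsubC_eq; rewrite /eigenvalues.
case: closed_field_poly_normal => r /= e.
rewrite big_map big_enum /= -h -/Pc [RHS]e.
by rewrite (monicP (char_poly_monic _)) scale1r.
Qed.

(** Index [i0] carries the eigenvalue 1. All other eigenvalues lie in the unit disc and differ from
    1, so their real parts are below 1: the sorted list starts with the 1 of [i0], and [lambda2] is
    the largest of the rest. *)
Lemma lambda2P : exists (i0 : 'I_n) (q : 'I_n -> R[i]),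
  [/\ forall i, i != i0 -> complex.Re (q i) <= lambda2 P,
      lambda2 P < 1 &
      real_complex R (\tr (fundamental P p)) = 1 + \sum_(i | i != i0) (1 - q i)^-1].
Proof.
have [i0 [q [hq q1 qn htr]]] := spec.
exists i0, q.
have q_le1 i : `|q i| <= 1 by exact: eigenvalue_norm.
pose rest := [seq complex.Re (q i) | i <- rem i0 (enum 'I_n)].
pose geR := fun a b : R => b <= a.
have geT : total geR by move=> a b; rewrite /geR orbC le_total.
have geTr : transitive geR by move=> a b c ab /le_trans; exact.
have geA : antisymmetric geR by move=> a b; rewrite /geR andbC; exact: le_anti.
have in_rest i : i != i0 -> complex.Re (q i) \in rest.
  by move=> ii0; apply: map_f; rewrite mem_rem_uniq ?enum_uniq // !inE ii0 mem_enum.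
have rest_lt x : x \in rest -> x < 1.
  move=> /mapP[k]; rewrite mem_rem_uniq ?enum_uniq // !inE => /andP[k0 _] ->.
  exact: Re_lt1 (q_le1 k) (qn k k0).
have perm : perm_eq [seq complex.Re z | z <- eigenvalues P] (1 :: rest).
  apply: (perm_trans (perm_map _ (perm_eigenvalues hq))).
  rewrite -map_comp; have := perm_to_rem (mem_enum 'I_n i0).
  by move/(perm_map (@complex.Re R \o q)) => /=; rewrite q1.
have sortE : sort geR [seq complex.Re z | z <- eigenvalues P] = 1 :: sort geR rest.
  apply: (sorted_eq geTr geA (sort_sorted geT _)).
    rewrite /= path_min_sorted ?sort_sorted //.
    by apply/allP => x; rewrite mem_sort => /rest_lt /ltW.
  rewrite perm_sort; apply: (perm_trans perm).
  by rewrite perm_cons perm_sym perm_sort.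
have lE : lambda2 P = nth 0 (sort geR rest) 0 by rewrite /lambda2 sortE.
split=> //.
- move=> i /in_rest; rewrite lE -(mem_sort geR).
  have := sort_sorted geT rest.
  case: (sort geR rest) => // a s /= pas; rewrite inE => /orP[/eqP ->//|].
  by move: pas => /(order_path_min geTr)/allP h /h.
(* With a single state [rest] is empty and [lambda2] is the default 0. *)
- rewrite lE; case E: (sort geR rest) => [|a s] /=; first by rewrite ltr01.
  by apply: rest_lt; rewrite -(mem_sort geR) E mem_head.
Qed.

Lemma eigengap_gt0 : 0 < eigengap P.
Proof. by have [i0 [q [_ h _]]] := lambda2P; rewrite subr_gt0. Qed.

(** The trace is real, so each inverse may be replaced by its real part, which is at most the
    inverse of the gap; there are at most [n] terms. *)
Lemma fundamental_trace_le :
  \tr (fundamental P p) - 1 <= n%:R / eigengap P.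
Proof.
have [i0 [q [h1 h2 h3]]] := lambda2P.
have -> : \tr (fundamental P p) = 1 + \sum_(i | i != i0) complex.Re (1 - q i)^-1.
  have ReD : {morph @complex.Re R : a b / a + b} by move=> [? ?] [? ?].
  have Re0 : complex.Re (0 : R[i]) = 0 by [].
  by rewrite -(big_morph _ ReD Re0); apply: etrans (ReD 1 _); rewrite -h3.
rewrite addrAC subrr add0r.
apply: (@le_trans _ _ (\sum_(i | i != i0) (eigengap P)^-1)).
  apply: ler_sum => i ii0; apply: Re_inv_le; first exact: eigengap_gt0.
  have -> : complex.Re (1 - q i) = 1 - complex.Re (q i) by case: (q i).
  by rewrite /eigengap lerD2l lerN2 h1.
rewrite sumr_const -[leLHS]mulr_natl ler_wpM2r ?invr_ge0 ?(ltW eigengap_gt0) //.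
by rewrite ler_nat -[leqRHS]card_ord max_card.
Qed.

Lemma poisson_solution (f : 'I_n -> R) F : (forall z, 0 <= f z <= F) ->
  exists g : 'I_n -> R, forall x,
    0 <= g x <= F * (n%:R / eigengap P) /\
    \sum_y P x y * g y = g x - (f x - \sum_z f z * p 0 z).
Proof.
move=> f0F.
(* The fundamental matrix applied to [f] solves the Poisson equation. *)
pose h x := \sum_z fundamental P p x z * f z.
have hP x : \sum_y P x y * h y = h x - (f x - \sum_z f z * p 0 z).
  have -> : f x = \sum_z (x == z)%:R * f z.
    rewrite (bigD1 x) //= eqxx mul1r big1 ?addr0 // => z zx.
    by rewrite eq_sym (negPf zx) mul0r.
  rewrite /h -!sumrB.
  under eq_bigr do rewrite mulr_sumr.
  rewrite exchange_big /=; apply: eq_bigr => z _.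
  rewrite (fundamental_poissonE stoP irrP statp x z).
  under eq_bigr do rewrite mulrA.
  by rewrite -mulr_suml; ring.
have osc x y : h x - h y <= F * (n%:R / eigengap P).
  rewrite /h -sumrB; under eq_bigr do rewrite -mulrBl.
  apply: le_trans (fundamental_osc stoP irrP statp x y f0F) _.
  apply: ler_wpM2l fundamental_trace_le.
  by have /andP[] := f0F x; exact: le_trans.
have [x0 _|no] := pickP 'I_n; last by exists h => x; have := no x.
pose m := [arg min_(i < x0) h i]%O.
have hm y : h m <= h y by rewrite /m; case: arg_minP => // i _ /(_ y isT).
(* Solutions may be shifted by constants; subtracting the minimum leaves values between 0 and the
   oscillation. *)
exists (fun x => h x - h m) => x; split; first by rewrite subr_ge0 hm osc.
under eq_bigr do rewrite mulrBr.
by rewrite sumrB hP -mulr_suml (stochastic_sum stoP) mul1r; ring.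
Qed.

End Gap.

(** * Chernoff bound for the chain *)

Lemma Boole_seq d (T : measurableType d) (R : realType) (mu : {measure set T -> \bar R})
    (I : Type) (r : seq I) (A : I -> set T) :
  (forall i, measurable (A i)) ->
  (mu (\big[setU/set0]_(i <- r) A i) <= \sum_(i <- r) mu (A i))%E.
Proof.
move=> mA; elim: r => [|i r IH]; first by rewrite !big_nil measure0.
rewrite !big_cons; apply: le_trans (measureU2 _ _ _) _ => //.
  exact: bigsetU_measurable.
by rewrite leeD2l.
Qed.

Section ExponentialMoment.
Variables (R : realType) (n : nat) (P : 'M[R]_n).
Hypothesis stoP : stochastic P.

(** All words of length [m], so that exponential moments become finite sums weighted by
    [path_prob]. *)
Fixpoint paths m : seq (seq 'I_n) :=
  if m is m'.+1 then flatten [seq [seq x :: p | p <- paths m'] | x <- enum 'I_n]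
  else [:: [::]].

Fixpoint path_prob x (p : seq 'I_n) : R :=
  if p is y :: p' then P x y * path_prob y p' else 1.

Lemma big_paths m (F : seq 'I_n -> R) :
  \sum_(p <- paths m.+1) F p = \sum_x \sum_(p <- paths m) F (x :: p).
Proof.
rewrite /= big_flatten big_map -[RHS]big_enum /=; apply: eq_bigr => x _.
by rewrite big_map.
Qed.

Lemma path_prob_ge0 x p : 0 <= path_prob x p.
Proof.
by elim: p x => //= y p IH x; rewrite mulr_ge0 ?(stochastic_ge0 stoP).
Qed.

Lemma mem_paths (y : nat -> 'I_n) m : mkseq y m \in paths m.
Proof.
elim: m y => // m IH y.
rewrite /mkseq /= -[1%N]addn0 iotaDl -map_comp; apply/flatten_mapP.
exists (y 0%N); first by rewrite mem_enum.
by rewrite map_f // (IH (y \o S)).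
Qed.

Lemma size_paths m p : p \in paths m -> size p = m.
Proof.
elim: m p => [|m IH] p; first by rewrite inE => /eqP ->.
by move=> /flatten_mapP[x _ /mapP[q /IH <- ->]].
Qed.

Lemma path_probE x0 x p :
  path_prob x p = \prod_(k < size p) P (nth x0 (x :: p) k) (nth x0 (x :: p) k.+1).
Proof.
elim: p x => [|y p IH] x; first by rewrite big_ord0.
by rewrite /= big_ord_recl /= IH.
Qed.

Variables (phi g : 'I_n -> R) (th D l : R).
Hypothesis phi_le : forall x, `|phi x| <= th.
Hypothesis g_ge0 : forall x, 0 <= g x.
Hypothesis g_le : forall x, g x <= D.
Hypothesis poisson : forall x, \sum_y P x y * g y = g x - phi x.
Hypothesis l_ge0 : 0 <= l.

(* [1 + l g] is an approximate eigenvector of the operator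
   [e^(l phi) P], because [P (1 + l g) = 1 + l g - l phi]. *)
Lemma exp_step x : expR (l * phi x) * \sum_y P x y * (1 + l * g y) <=
  expR (l ^+ 2 * th * D) * (1 + l * g x).
Proof.
have -> : \sum_y P x y * (1 + l * g y) = 1 + l * g x - l * phi x.
  under eq_bigr do rewrite mulrDr mulr1 mulrCA.
  by rewrite big_split /= -mulr_sumr poisson (stochastic_sum stoP) mulrBr addrA.
set h := 1 + l * g x; set f := l * phi x.
have w0 : 0 <= l * g x by rewrite mulr_ge0.
have wD : l * g x <= l * D by rewrite ler_wpM2l.
have h1 : 1 <= h by rewrite /h lerDl.
have h0 : 0 < h by lra.
have f1 : `|f| <= l * th by rewrite /f normrM ger0_norm // ler_wpM2l.
have : h - f <= h * expR (- f + l ^+ 2 * th * D).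
  apply: (@le_trans _ _ (h * (1 + (- f + l ^+ 2 * th * D)))); last first.
    by rewrite ler_wpM2l ?expR_ge1Dx // ltW.
  suff : f * (h - 1) <= h * (l ^+ 2 * th * D) by lra.
  apply: (@le_trans _ _ ((l * th) * (l * D))).
    have -> : h - 1 = l * g x by rewrite /h addrAC subrr add0r.
    apply: (@le_trans _ _ (`|f| * (l * g x))); first by rewrite ler_wpM2r ?ler_norm.
    by apply: ler_pM.
  have th0 : 0 <= l * th by apply: le_trans f1.
  have D0 : 0 <= l * D by apply: le_trans wD.
  have -> : l ^+ 2 * th * D = (l * th) * (l * D) by ring.
  by rewrite ler_peMl // mulr_ge0.
rewrite -(ler_pM2l (expR_gt0 f)) => /le_trans; apply.
by rewrite mulrCA -expRD addrA subrr add0r mulrC.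
Qed.

(** Induction on the number of transitions, with one use of [exp_step] per state. The starting state
    [x] also contributes to the exponent, hence the power [m.+1]. *)
Lemma exp_moment m x :
  \sum_(p <- paths m) path_prob x p * expR (l * \sum_(z <- x :: p) phi z) <=
  expR (l ^+ 2 * th * D) ^+ m.+1 * (1 + l * g x).
Proof.
elim: m x => [|m IH] x.
  rewrite big_seq1 /= big_seq1 mul1r expr1; apply: le_trans (exp_step x).
  (* Since [1 + l g] is at least 1, so is its [P]-average, which may therefore be inserted. *)
  rewrite ler_peMr ?expR_ge0 // -[leLHS](stochastic_sum stoP x).
  apply: ler_sum => y _; rewrite ler_peMr ?(stochastic_ge0 stoP) //.
  by rewrite lerDl mulr_ge0.
rewrite big_paths.
apply: (@le_trans _ _ (\sum_y expR (l * phi x) * (P x y *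
    (expR (l ^+ 2 * th * D) ^+ m.+1 * (1 + l * g y))))).
  apply: ler_sum => y _.
  rewrite -ler_pdivrMl ?expR_gt0 //.
  apply: le_trans _ (ler_wpM2l (stochastic_ge0 stoP x y) (IH y)).
  rewrite !mulr_sumr le_eqVlt; apply/orP; left; apply/eqP.
  apply: eq_bigr => p _ /=.
  rewrite [in LHS]big_cons mulrDr expRD.
  have := expR_gt0 (l * phi x); move: (expR (l * phi x)) => e e0.
  by field; rewrite gt_eqF.
rewrite -mulr_sumr; under eq_bigr do rewrite mulrCA.
rewrite -mulr_sumr (exprSr _ m.+1) mulrCA -[leRHS]mulrA.
by apply: ler_wpM2l (exp_step x); rewrite exprn_ge0 ?expR_ge0.
Qed.

Context (d : measure_display) (T : measurableType d) (Pr : probability T R).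
Variable Y : nat -> T -> 'I_n.
Hypothesis mY : forall k z, measurable [set w | Y k w = z].
Hypothesis lawY : forall m (x : nat -> 'I_n),
  Pr [set w | forall k, (k <= m)%N -> Y k w = x k] =
  (Pr [set w | forall k, (k <= 0)%N -> Y k w = x k] *
   (\prod_(k < m) P (x k) (x k.+1))%:E)%E.

Let cyl x0 (p : seq 'I_n) := [set w | forall k, (k < size p)%N -> Y k w = nth x0 p k].

Lemma measurable_cyl x0 p : measurable (cyl x0 p).
Proof.
rewrite (_ : cyl x0 p = \big[setI/setT]_(k < size p) [set w | Y k w = nth x0 p k]).
  by apply: bigsetI_measurable.
by rewrite -(bigcap_mkord _ (fun k => [set w | Y k w = nth x0 p k])); apply/seteqP; split.
Qed.

Let p0 x := fine (Pr [set w | Y 0%N w = x]).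

Let p0E x : Pr [set w | Y 0%N w = x] = (p0 x)%:E.
Proof. by rewrite fineK ?fin_num_measure. Qed.

Let p0_ge0 x : 0 <= p0 x.
Proof. by rewrite fine_ge0. Qed.

Let p0_sum : \sum_x p0 x <= 1.
Proof.
rewrite -lee_fin -sumEFin; under eq_bigr do rewrite -p0E.
rewrite -measure_bigsetU_ord //.
  by apply: probability_le1; exact: bigsetU_measurable.
apply/trivIsetP => i j _ _ ij; apply/seteqP; split => w //= [-> /eqP].
by rewrite (negPf ij).
Qed.

Lemma Pr_cyl x0 x p : Pr (cyl x0 (x :: p)) = (p0 x * path_prob x p)%:E.
Proof.
have := lawY (size p) (nth x0 (x :: p)); rewrite -path_probE EFinM -p0E => e.
rewrite [LHS]e; congr (Pr _ * _)%E; apply/seteqP; split => w /=; first exact.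
by move=> h k; rewrite leqn0 => /eqP ->.
Qed.

(** The event is a finite union of cylinders of explicit probability; the exponential Markov
    inequality is applied word by word and the sum is an exponential moment. *)
Lemma chernoff_exp m u : 0 <= D ->
  measurable [set w | u <= \sum_(k < m.+1) phi (Y k w)] /\
  (Pr [set w | (u <= \sum_(k < m.+1) phi (Y k w))%R] <=
   (expR (- (l * u)) * expR (l ^+ 2 * th * D) ^+ m.+1 * (1 + l * D))%:E)%E.
Proof.
move=> D0; set E := [set w | _].
(* A point of the event supplies a state [x0], used as the default of [nth]; for an empty event the
   bound only has to be nonnegative. *)
have [[w0 _]|/nonemptyPn ->] := pselect (E !=set0); last first.
  split=> //; rewrite measure0 lee_fin !mulr_ge0 ?exprn_ge0 ?expR_ge0 //.
  by rewrite addr_ge0 ?mulr_ge0.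
pose x0 := Y 0%N w0.
pose r := [seq q <- paths m.+1 | u <= \sum_(z <- q) phi z].
have cylU : E = \bigcup_(q in [set` r]) cyl x0 q.
  apply/seteqP; split => w /=.
    move=> uw; exists (mkseq (Y^~ w) m.+1).
      rewrite /= mem_filter mem_paths andbT big_map.
      have : u <= \sum_(k < m.+1) phi (Y k w) := uw.
      by rewrite -(big_mkord xpredT (fun k => phi (Y k w))) /index_iota subn0.
    by move=> k; rewrite size_mkseq => km; rewrite nth_mkseq.
  move=> [q]; rewrite /= mem_filter => /andP[uq /size_paths sq] h.
  rewrite /E /=; apply: (le_trans uq); rewrite (big_nth x0) sq big_mkord le_eqVlt.
  apply/orP; left; apply/eqP; apply: eq_bigr => k _; congr (phi _).
  by apply/esym/h; rewrite sq.
rewrite cylU bigcup_seq; split.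
  by apply: bigsetU_measurable => q _; exact: measurable_cyl.
apply: le_trans (Boole_seq _ _ _) _; first by move=> q; exact: measurable_cyl.
pose wt q := if q is x :: p then p0 x * path_prob x p else 1.
have wt_ge0 q : 0 <= wt q.
  by case: q => //= x p; rewrite mulr_ge0 ?path_prob_ge0.
have wtE q : Pr (cyl x0 q) = (wt q)%:E.
  case: q => [|x p]; last exact: Pr_cyl.
  by rewrite /= -(@probability_setT _ _ _ Pr); congr (Pr _); apply/seteqP; split.
rewrite (eq_bigr (EFin \o wt)) => [|q _]; last exact: wtE.
rewrite sumEFin lee_fin big_filter.
(* On the selected words the inserted factor is the exponential of [l] times a nonnegative excess
   over [u], hence at least 1; the other words only add nonnegative terms. *)
apply: (@le_trans _ _ (\sum_(q <- paths m.+1)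
    wt q * (expR (- (l * u)) * expR (l * \sum_(z <- q) phi z)))).
  rewrite big_mkcond /=; apply: ler_sum => q _; case: ifP => uq; last first.
    by rewrite mulr_ge0 // mulr_ge0 ?expR_ge0.
  rewrite ler_peMr // -expRD -expR0 ler_expR addrC subr_ge0.
  by rewrite ler_wpM2l.
rewrite big_paths.
apply: (@le_trans _ _ (\sum_x p0 x *
    (expR (- (l * u)) * expR (l ^+ 2 * th * D) ^+ m.+1 * (1 + l * D)))).
  apply: ler_sum => x _; rewrite /wt.
  under eq_bigr do rewrite -mulrA.
  rewrite -mulr_sumr ler_wpM2l //.
  under eq_bigr do rewrite mulrCA.
  rewrite -mulr_sumr -[leRHS]mulrA ler_wpM2l ?expR_ge0 //.
  apply: le_trans (exp_moment m x) _.
  by rewrite ler_wpM2l ?exprn_ge0 ?expR_ge0 // lerD2l ler_wpM2l.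
rewrite -mulr_suml ler_piMl // !mulr_ge0 ?exprn_ge0 ?expR_ge0 //.
by rewrite addr_ge0 ?mulr_ge0.
Qed.

End ExponentialMoment.

(** * Two-sided deviation of the empirical mean *)

Section Tail.
Variables (R : realType) (n : nat) (P : 'M[R]_n).
Hypothesis stoP : stochastic P.
Context (d : measure_display) (T : measurableType d) (Pr : probability T R).
Variable Y : nat -> T -> 'I_n.
Hypothesis mY : forall k z, measurable [set w | Y k w = z].
Hypothesis lawY : forall m (x : nat -> 'I_n),
  Pr [set w | forall k, (k <= m)%N -> Y k w = x k] =
  (Pr [set w | forall k, (k <= 0)%N -> Y k w = x k] *
   (\prod_(k < m) P (x k) (x k.+1))%:E)%E.

Lemma chernoff (phi g : 'I_n -> R) (th D L : R) (m t : nat) :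
  (forall x, `|phi x| <= th) -> (forall x, 0 <= g x) -> (forall x, g x <= D) ->
  (forall x, \sum_y P x y * g y = g x - phi x) ->
  0 < th -> 0 < D -> 90 * (th * D) <= L -> (0 < m)%N -> (1 < t)%N ->
  measurable [set w | Num.sqrt (m%:R * (L * ln t%:R)) <= \sum_(k < m) phi (Y k w)] /\
  (Pr [set w | (Num.sqrt (m%:R * (L * ln t%:R)) <= \sum_(k < m) phi (Y k w))%R] <=
   (3 / 2 * (t%:R ^+ 5)^-1)%:E)%E.
Proof.
move=> phi_le g0 gD poi th0 D0 hL m0 t1.
set u := Num.sqrt _.
have t0 : (0 : R) < t%:R by rewrite ltr0n (ltn_trans _ t1).
have lnt0 : 0 <= ln (t%:R : R) by rewrite ln_ge0 // ler1n ltnW.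
have thD : 0 < th * D by rewrite mulr_gt0.
have L0 : 0 < L by apply: lt_le_trans hL; rewrite mulr_gt0.
have mR : (0 : R) < m%:R by rewrite ltr0n.
have u0 : 0 <= u by rewrite sqrtr_ge0.
have u2 : u ^+ 2 = m%:R * (L * ln t%:R).
  by rewrite sqr_sqrtr // mulr_ge0 ?ler0n // mulr_ge0 // ltW.
(* Beyond [m * th] the event is empty. Otherwise the [l] chosen below satisfies [l * D <= 1 / 2],
   which is where the factor [3 / 2] comes from. *)
have [um|um] := ltP (m%:R * th) u.
  rewrite (_ : [set w | _] = set0); last first.
    apply/seteqP; split => // w /= h.
    suff : \sum_(k < m) phi (Y k w) <= m%:R * th.
      by move=> /(le_trans h); rewrite leNgt um.
    rewrite mulr_natl -[X in _ *+ X]card_ord -sumr_const ler_sum // => k _.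
    exact: le_trans (ler_norm _) (phi_le _).
  split; first exact: measurable0.
  by rewrite measure0 lee_fin mulr_ge0 ?invr_ge0 ?exprn_ge0 // ltW.
(* The minimizer of [- l u + m l ^ 2 th D]; the minimum is [- u ^ 2 / (4 m th D)], that is
   [- L ln t / (4 th D)], which the lower bound on [L] puts below [- 5 ln t]. *)
pose l := u / (2 * m%:R * (th * D)).
have c0 : 0 < 2 * m%:R * (th * D) by rewrite !mulr_gt0.
have l0 : 0 <= l by rewrite divr_ge0 // ltW.
have [] := chernoff_exp stoP phi_le g0 gD poi l0 mY lawY m.-1 u (ltW D0).
rewrite prednK // => mE /le_trans h; split; first exact: mE.
apply: h; rewrite lee_fin mulrC -expRM_natl -expRD; apply: ler_pM => //.
- exact: addr_ge0 ler01 (mulr_ge0 l0 (ltW D0)).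
- have -> : l * D = u / (m%:R * th) / 2.
    by rewrite /l; field; rewrite !gt_eqF.
  have : u / (m%:R * th) <= 1 by rewrite ler_pdivrMr ?mulr_gt0 // mul1r.
  lra.
- have -> : (t%:R ^+ 5)^-1 = expR (- (5 * ln (t%:R : R))).
    by rewrite expRN expRM_natl lnK.
  rewrite ler_expR.
  have -> : - (l * u) + m%:R * (l ^+ 2 * th * D) = - (u ^+ 2 / (4 * m%:R * (th * D))).
    by rewrite /l; field; rewrite !gt_eqF.
  rewrite u2 lerN2 ler_pdivlMr ?mulr_gt0 //.
  have : ln (t%:R : R) * m%:R * (90 * (th * D)) <= ln t%:R * m%:R * L.
    by rewrite ler_wpM2l // mulr_ge0 // ltW.
  have : 0 <= ln (t%:R : R) * m%:R * (th * D) by rewrite !mulr_ge0 // ltW.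
  lra.
Qed.

Hypothesis irrP : irreducible_chain P.
Variable p : 'rV[R]_n.
Hypothesis statp : stationary_distribution P p.

Lemma mean_tail (f : 'I_n -> R) (th L : R) (m t : nat) :
  (forall x, 0 <= f x <= th) -> 0 < th -> (0 < n)%N ->
  90 * (th * (th * (n%:R / eigengap P))) <= L -> (0 < m)%N -> (1 < t)%N ->
  let B := [set w | Num.sqrt (L * ln t%:R / m%:R) <=
    `|(\sum_(k < m) f (Y k w)) / m%:R - \sum_z f z * p 0 z| ] in
  measurable B /\ (Pr B <= (3 * (t%:R ^+ 5)^-1)%:E)%E.
Proof.
move=> f0 th0 n0 hL m0 t1 B.
have eps0 := eigengap_gt0 stoP irrP statp.
set D := th * (n%:R / eigengap P) in hL.
have D0 : 0 < D by rewrite mulr_gt0 // divr_gt0 // ltr0n.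
set mu := \sum_z _ in B *.
have mu0 : 0 <= mu <= th.
  have p0 z : 0 <= p 0 z by apply: (proj1 (proj1 statp)).
  apply/andP; split.
    by apply: sumr_ge0 => z _; rewrite mulr_ge0 //; have /andP[] := f0 z.
  rewrite -[leRHS]mulr1 -(proj2 (proj1 statp)) mulr_sumr; apply: ler_sum => z _.
  by rewrite ler_wpM2r //; have /andP[] := f0 z.
have phi_le x : `|f x - mu| <= th.
  by have := f0 x; move: mu0; rewrite ler_norml => /andP[? ?] /andP[? ?]; lra.
have [g hg] := poisson_solution stoP irrP statp f0.
have g0 x : 0 <= g x by have [/andP[]] := hg x.
have gD x : g x <= D by have [/andP[]] := hg x.
have [m1 P1] := chernoff phi_le g0 gD (fun x => proj2 (hg x)) th0 D0 hL m0 t1.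
have phi_le' x : `|- (f x - mu)| <= th by rewrite normrN.
(* For the lower tail, [D - g] solves the Poisson equation of the opposite function and still lies
   between 0 and [D]. *)
have poi x : \sum_y P x y * (D - g y) = D - g x - - (f x - mu).
  under eq_bigr do rewrite mulrBr.
  by rewrite sumrB (proj2 (hg x)) -/mu -mulr_suml (stochastic_sum stoP) mul1r; ring.
have g0' x : 0 <= D - g x by rewrite subr_ge0.
have gD' x : D - g x <= D by rewrite gerBl.
have [m2 P2] := chernoff phi_le' g0' gD' poi th0 D0 hL m0 t1.
set u := Num.sqrt (m%:R * (L * ln t%:R)) in m1 P1 m2 P2.
set E1 := [set w | _] in m1 P1; set E2 := [set w | _] in m2 P2.
have mR : (0 : R) < m%:R by rewrite ltr0n.
have -> : B = E1 `|` E2.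
  have sqE : Num.sqrt (L * ln t%:R / m%:R) = u / m%:R.
    have -> : L * ln t%:R / m%:R = (m%:R * (L * ln t%:R)) / m%:R ^+ 2.
      by field; rewrite gt_eqF.
    rewrite sqrtrM; last first.
      have thD : 0 < th * D by rewrite mulr_gt0.
      by rewrite !mulr_ge0 ?ln_ge0 ?ler1n ?(ltnW t1) //; move: hL thD; lra.
    by rewrite sqrtrV ?sqr_ge0 // sqrtr_sqr gtr0_norm.
  have E w : (\sum_(k < m) f (Y k w)) / m%:R - mu =
      (\sum_(k < m) (f (Y k w) - mu)) / m%:R.
    rewrite sumrB sumr_const card_ord -(mulr_natl mu) mulrBl.
    by rewrite [_ * mu / _]mulrAC divff ?mul1r // gt_eqF.
  apply/seteqP; rewrite /B /E1 /E2; split => w /=; rewrite sqE E sumrN;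
    rewrite normrM (gtr0_norm (_ : 0 < m%:R^-1)) ?invr_gt0 // ler_pM2r ?invr_gt0 //.
    rewrite real_ler_normr ?num_real // => /orP[]; by [left|right].
  by rewrite ler_normr => -[->|->]; rewrite ?orbT.
split; first exact: measurableU.
apply: le_trans (measureU2 _ m1 m2) _.
apply: le_trans (leeD P1 P2) _; rewrite -EFinD lee_fin.
by rewrite -mulrDl ler_wpM2r ?invr_ge0 ?exprn_ge0 //; lra.
Qed.

End Tail.

(** * Counting suboptimal plays along a run *)

Section Counting.
Variables (R : realType) (M N : nat) (s : 'I_M -> 'I_N -> nat).
Variables (stat : forall i j, 'rV[R]_(s i j)) (theta : forall i j, 'I_(s i j) -> R).
Variables (alpha : policy R M N) (x : forall i j, nat -> 'I_(s i j)).

Local Notation run := (run theta alpha x).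

Lemma size_run n : size (run n) = n.
Proof. by elim: n => //= n IH; rewrite size_rcons IH. Qed.

Lemma plays_rcons (h : history R M N) o i j :
  plays (rcons h o) i j = (plays h i j + (o.1 i == j))%N.
Proof. by rewrite /plays -cats1 count_cat /= addn0. Qed.

Lemma plays_run_le n i j : (plays (run n) i j <= n)%N.
Proof. by rewrite -[leqRHS](size_run n) count_size. Qed.

Lemma plays_run_mono m n i j : (m <= n)%N -> (plays (run m) i j <= plays (run n) i j)%N.
Proof.
elim: n => [|n IH]; first by rewrite leqn0 => /eqP ->.
rewrite leq_eqVlt => /orP[/eqP -> //|/IH h].
by rewrite /= plays_rcons (leq_trans h) // leq_addr.
Qed.

(** Rested chains: the past enters the sample mean only through the play count, so deviations can be
    controlled for each fixed count. *)
Lemma sample_mean_run n i j :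
  sample_mean (run n) i j =
  (\sum_(k < plays (run n) i j) theta (x i j k)) / (plays (run n) i j)%:R.
Proof.
rewrite /sample_mean; congr (_ / _).
elim: n => [|n IH]; first by rewrite big_nil big_ord0.
rewrite [in LHS]/= -cats1 big_cat IH big_cons big_nil /= plays_rcons /=.
case: eqP => [<-|_]; last by rewrite addn0 addr0.
by rewrite addn1 big_ord_recr /= ffunE addr0.
Qed.

Lemma arm_plays_run n a :
  arm_plays (run n) a = (\sum_(t < n) (alpha (run t) == a))%N.
Proof.
elim: n => [|n IH]; first by rewrite big_ord0.
by rewrite big_ord_recr /= -IH /arm_plays -cats1 count_cat /= addn0.
Qed.

Lemma sum_arm_plays_run n (A : pred (arm M N)) :
  (\sum_(a | A a) arm_plays (run n) a = \sum_(t < n) A (alpha (run t)))%N.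
Proof.
under eq_bigr do rewrite arm_plays_run.
rewrite exchange_big /=; apply: eq_bigr => t _.
rewrite big_mkcond (bigD1 (alpha (run t))) //= eqxx big1 ?addn0.
  by case: (A _).
by move=> a; rewrite eq_sym => /negPf ->; case: (A a).
Qed.

Variable L : R.
Hypothesis L0 : 0 < L.
Hypothesis mlmr : is_MLMR L alpha.

Lemma plays_after_init n i j : (M * N <= n)%N -> (0 < plays (run n) i j)%N.
Proof.
have [[e [bij_e he]] _] := mlmr => MNn.
have [e' eK e'K] := bij_e; pose t := e' (i, j).
have tn : (t < n)%N by exact: leq_trans (ltn_ord t) MNn.
apply: leq_trans (plays_run_mono i j tn).
have := he (run t) t (size_run t); rewrite /= plays_rcons /t e'K /= => ->.
by rewrite eqxx addn1.
Qed.

Definition pair_dev i j m : R :=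
  `|(\sum_(k < m) theta (x i j k)) / m%:R - pair_mean stat theta i j|.

(* The arm of slot t is chosen at time [t.+1], after t observations. *)
Definition bad_slot t : bool :=
  [exists i, exists j, exists m : 'I_t,
    Num.sqrt (L * ln t.+1%:R / m.+1%:R) <= pair_dev i j m.+1].

Variables (astar : arm M N) (Delta : R) (n : nat).
Hypothesis astarE : arm_mean stat theta astar = mu_star stat theta.
Hypothesis Delta0 : 0 < Delta.
Hypothesis gapD : forall a, arm_mean stat theta a < mu_star stat theta ->
  Delta <= gap stat theta a.

(** The play count from which a confidence radius at any time up to [n] is at most
    [Delta / (2 M)]. *)
Let l : R := 4 * M%:R ^+ 2 * L * ln n%:R / Delta ^+ 2.

Definition suboptimal (a : arm M N) : bool :=
  arm_mean stat theta a < mu_star stat theta.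

(** If all pairs of the chosen arm had reached [l] plays, its index would exceed its mean by less
    than [Delta] and stay below [mu_star], whereas the index of [astar] is at least [mu_star]. *)
Lemma suboptimal_play t : (0 < M)%N -> (M * N <= t)%N -> (t < n)%N ->
  ~~ bad_slot t -> suboptimal (alpha (run t)) ->
  exists i, (plays (run t) i (alpha (run t) i))%:R < l.
Proof.
move=> M0 MNt tn nbad sub; set h := run t; set a := alpha h.
apply/existsP; apply: contraT => /existsPn lq.
have t1 : (0 < t.+1)%N by [].
pose c i j := Num.sqrt (L * ln t.+1%:R / (plays h i j)%:R).
have near i j : `|sample_mean h i j - pair_mean stat theta i j| < c i j.
  rewrite sample_mean_run ltNge; apply: contra nbad => dev.
  have q0 := plays_after_init i j MNt; have qt := plays_run_le t i j.
  apply/existsP; exists i; apply/existsP; exists j; apply/existsP.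
  have qt' : ((plays h i j).-1 < t)%N by rewrite prednK.
  by exists (Ordinal qt') => /=; rewrite prednK.
have c_le i : c i (a i) <= Delta / (2 * M%:R).
  have := lq i; rewrite -leNgt => {}lq.
  have q0 : (0 : R) < (plays h i (a i))%:R by rewrite ltr0n plays_after_init.
  have MR : (0 : R) < M%:R by rewrite ltr0n.
  have D0 : 0 <= Delta / (2 * M%:R) by rewrite divr_ge0 // ltW // mulr_gt0.
  rewrite /c -[leRHS](gtr0_norm (_ : 0 < _)) ?divr_gt0 ?mulr_gt0 // -sqrtr_sqr.
  rewrite ler_wsqrtr // ler_pdivrMr //.
  have : L * ln t.+1%:R <= L * ln n%:R.
    by rewrite ler_pM2l // ler_ln ?posrE ?ltr0n ?ler_nat // (leq_trans t1).
  move=> /le_trans; apply.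
  move: lq; rewrite /l ler_pdivrMr ?exprn_gt0 // => lq.
  rewrite expr_div_n mulrAC ler_pdivlMr ?exprn_gt0 ?mulr_gt0 //.
  by move: lq; rewrite exprMn; lra.
have lt_index : mlmr_index L h a < mu_star stat theta.
  apply: (@lt_le_trans _ _ (\sum_(i < M) (pair_mean stat theta i (a i) + Delta / M%:R))).
    apply: ltr_sum; first by apply/hasP; exists (Ordinal M0); rewrite ?mem_index_enum.
    move=> i _; rewrite /mlmr_index size_run -/(c i (a i)).
    have := near i (a i); have := c_le i; rewrite ltr_norml => h1 /andP[_ h2].
    (* Two radii per pair: one for the estimation error, one for the bonus in the index. *)
    have -> : Delta / M%:R = 2 * (Delta / (2 * M%:R)).
      by field; rewrite pnatr_eq0 -lt0n.
    lra.
  rewrite big_split /= sumr_const card_ord -(mulr_natr (Delta / _)).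
  rewrite divfK ?pnatr_eq0 -?lt0n //.
  by have := gapD sub; rewrite /gap /arm_mean; lra.
have : mu_star stat theta <= mlmr_index L h astar.
  rewrite -astarE; apply: ler_sum => i _; rewrite size_run -/(c i (astar i)).
  by have := near i (astar i); rewrite ltr_norml; lra.
have := proj2 mlmr h; rewrite size_run => /(_ MNt astar) h1 h2.
by have := le_lt_trans (le_trans h2 h1) lt_index; rewrite ltxx.
Qed.

(** Initialization slots are charged whether bad or not; the suboptimal slots left out are the bad
    ones after initialization. *)
Definition charged t : bool :=
  suboptimal (alpha (run t)) && ((t < M * N)%N || ~~ bad_slot t).

Lemma threshold_ge0 : 0 <= l.
Proof.
rewrite divr_ge0 ?exprn_ge0 ?(ltW Delta0) //.
rewrite !mulr_ge0 ?exprn_ge0 ?(ltW L0) //.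
by have [->|n0] := posnP n; [rewrite ln0|rewrite ln_ge0 // ler1n].
Qed.

(* Each charged slot is paid for by one pair of the arm it plays: the pair being
   initialized, or a pair whose play count is still below the threshold. *)
Lemma charge_counters (e : 'I_(M * N) -> 'I_M * 'I_N) n' :
  injective e ->
  (forall h (t : 'I_(M * N)), size h = t -> alpha h (e t).1 = (e t).2) ->
  (0 < M)%N -> (n' <= n)%N ->
  exists c : 'I_M -> 'I_N -> nat,
    [/\ (\sum_(t < n') charged t <= \sum_i \sum_j c i j)%N,
        forall i j, (c i j <= plays (run n') i j)%N,
        forall i j, (c i j)%:R <= l + 1 &
        forall t : 'I_(M * N), (n' <= t)%N -> c (e t).1 (e t).2 = 0%N].
Proof.
move=> inj_e he M0; elim: n' => [_|n' IH n'n].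
  exists (fun _ _ => 0%N); split => //; first by rewrite big_ord0.
  by move=> _ _; rewrite addr_ge0 ?threshold_ge0.
have [c [c1 c2 c3 c4]] := IH (ltnW n'n).
have [nc|ch] := boolP (~~ charged n').
  exists c; split => //.
  - by rewrite big_ord_recr /= (negPf nc) addn0.
  - by move=> i j; rewrite (leq_trans (c2 i j)) //= plays_rcons leq_addr.
  - by move=> t n't; apply: c4; exact: ltnW.
have [i0 [hi0 hc]] : exists i0,
    ((c i0 (alpha (run n') i0))%:R <= l) /\
    forall t : 'I_(M * N), (n' < t)%N -> e t != (i0, alpha (run n') i0).
  move: ch; rewrite negbK => /andP[sub].
  (* During initialization the slot is charged to its own pair, whose counter is still 0 by the last
     invariant; injectivity of [e] keeps the later pairs untouched. Afterwards, the counter is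
     bounded by a play count below [l]. *)
  have [n'MN _|MNn' /= nb] := ltnP n' (M * N).
    pose t0 := Ordinal n'MN; exists (e t0).1.
    have := he (run n') t0 (size_run n') => ->.
    split; first by rewrite c4 ?threshold_ge0.
    move=> t n't; apply: contraL n't => /eqP/=.
    rewrite -surjective_pairing => /inj_e ->.
    by rewrite ltnn.
  have [i hi] := suboptimal_play M0 MNn' n'n nb sub.
  exists i; split; first by apply: le_trans (ltW hi); rewrite ler_nat.
  by move=> t n't; have := leq_ltn_trans MNn' n't; rewrite ltnNge ltnW.
set j0 := alpha (run n') i0 in hi0 hc.
exists (fun i j => (c i j + ((i, j) == (i0, j0)))%N); split.
- rewrite big_ord_recr /=.
  under [leqRHS]eq_bigr do rewrite big_split.
  rewrite big_split leq_add // (bigD1 i0) //= (bigD1 j0) //= eqxx.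
  by case: charged.
- move=> i j; rewrite /= plays_rcons leq_add //=.
  by case: eqP => [[-> ->]|//]; rewrite eqxx.
- move=> i j; rewrite natrD; case: eqP => [[-> ->]|_]; first by rewrite lerD2r.
  by rewrite addr0.
- move=> t n't; rewrite -surjective_pairing (negPf (hc t n't)) addn0.
  by apply: c4; exact: ltnW.
Qed.

Lemma suboptimal_plays_le : (0 < M)%N ->
  (\sum_(a | suboptimal a) arm_plays (run n) a)%:R <=
  M%:R * N%:R * (l + 1) + \sum_(t < n | (M * N <= t)%N) (bad_slot t)%:R.
Proof.
move=> M0; have [[e [bij_e he]] _] := mlmr.
have [c [c1 _ c3 _]] := charge_counters (bij_inj bij_e) he M0 (leqnn n).
rewrite sum_arm_plays_run.
apply: (@le_trans _ _ ((\sum_(t < n) charged t)%N +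
    (\sum_(t < n | (M * N <= t)%N) bad_slot t)%N)%:R).
  rewrite ler_nat [X in (_ <= _ + X)%N]big_mkcond -big_split leq_sum //= => t _.
  rewrite /charged; case: suboptimal => //=.
  by case: (ltnP t (M * N)) => _ //=; case: bad_slot.
rewrite natrD [X in _ + X <= _]natr_sum lerD2r.
apply: (@le_trans _ _ (\sum_i \sum_j c i j)%N%:R); first by rewrite ler_nat.
rewrite natr_sum; under eq_bigr do rewrite natr_sum.
apply: (@le_trans _ _ (\sum_(i < M) \sum_(j < N) (l + 1))).
  by apply: ler_sum => i _; apply: ler_sum => j _.
by rewrite !sumr_const !card_ord -(mulr_natl (_ *+ N)) -(mulr_natl (l + 1)) mulrA.
Qed.

End Counting.

(** * Expected number of suboptimal plays *)

Lemma finite_max (R : realType) (I : finType) (A : set I) (F : I -> R) i0 : A i0 ->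
  exists i, [/\ A i, sup (F @` A) = F i & forall j, A j -> F j <= sup (F @` A)].
Proof.
move=> Ai0; pose a := [pred i | i \in A].
have ai0 : a i0 by rewrite /= inE.
pose m := [arg max_(i > i0 | a i) F i]%O.
have [Am mmax] : A m /\ forall j, A j -> F j <= F m.
  rewrite /m; case: arg_maxP => // k; rewrite /= inE => Ak h; split => // j Aj.
  by apply: h; rewrite /= inE.
have ub : ubound (F @` A) (F m) by move=> _ [j Aj <-]; exact: mmax.
have e : sup (F @` A) = F m.
  apply/eqP; rewrite eq_le ge_sup //=; last by exists (F i0), i0.
  by apply: ub_le_sup; [exists (F m)|exists m].
by exists m; split => // j; rewrite e; exact: mmax.
Qed.

Lemma finite_min (R : realType) (I : finType) (A : set I) (F : I -> R) i0 : A i0 ->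
  exists i, [/\ A i, inf (F @` A) = F i & forall j, A j -> inf (F @` A) <= F j].
Proof.
move=> Ai0; have [i [Ai e h]] := finite_max (fun i => - F i) Ai0.
have eI : inf (F @` A) = - sup ((fun i => - F i) @` A).
  rewrite /inf; congr (- sup _); apply/seteqP; split => z /=.
    by move=> [_ [j Aj <-] <-]; exists j.
  by move=> [j Aj <-]; exists (F j) => //; exists j.
exists i; rewrite eI e opprK; split => // j Aj.
by rewrite -lerN2 -e; exact: h.
Qed.

(** * Measurability of functions of finitely many chain states *)

Section FiniteCode.
Context (d : measure_display) (T : measurableType d) (R : realType).

Lemma measurable_preimage_code (I : finType) (c : T -> I) (A : set T) :
  (forall z, measurable [set w | c w = z]) ->
  (forall w w', c w = c w' -> A w -> A w') -> measurable A.
Proof.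
move=> mc hA.
have -> : A = \bigcup_(z in [set z | exists2 w, c w = z & A w]) [set w | c w = z].
  apply/seteqP; split => w /=; first by move=> Aw; exists (c w) => //; exists w.
  by move=> [z [w' cw' Aw'] cw]; apply: hA Aw'; rewrite cw' cw.
by apply: fin_bigcup_measurable => //; exact: finite_finset.
Qed.

Lemma measurable_code (I : finType) (c : T -> I) (F : T -> R) :
  (forall z, measurable [set w | c w = z]) ->
  (forall w w', c w = c w' -> F w = F w') -> measurable_fun setT F.
Proof.
move=> mc hF _ B _; rewrite setTI; apply: measurable_preimage_code mc _.
by move=> w w' /hF e; rewrite /= /preimage /= e.
Qed.

End FiniteCode.

Section Runs.
Variables (R : realType) (M N : nat) (s : 'I_M -> 'I_N -> nat).
Variables (theta : forall i j, 'I_(s i j) -> R) (alpha : policy R M N).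
Arguments theta : clear implicits.

(** A pair has been played at most [n] times before slot [n.+1], so a run cannot look further into
    its chain. *)
Lemma eq_run (x y : forall i j, nat -> 'I_(s i j)) n :
  (forall i j k, (k < n)%N -> x i j k = y i j k) ->
  run theta alpha x n = run theta alpha y n.
Proof.
elim: n => // n IH xy /=.
rewrite IH => [|i j k kn]; last by rewrite xy // ltnW.
congr (rcons _ (_, _)); apply/ffunP => i; rewrite !ffunE xy //.
by rewrite ltnS plays_run_le.
Qed.

Context (d : measure_display) (T : measurableType d).
Variable X : forall i j, nat -> T -> 'I_(s i j).
Hypothesis mX : forall i j k z, measurable [set w | X i j k w = z].

(** All the states a run of [n] slots can read, packed into a finite type: functions of the run
    factor through it and are measurable. *)
Definition code n w : {dffun forall q : 'I_M * 'I_N * 'I_n, 'I_(s q.1.1 q.1.2)} :=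
  [ffun q : 'I_M * 'I_N * 'I_n => X q.1.1 q.1.2 q.2 w].

Lemma measurable_code_fiber n z : measurable [set w | code n w = z].
Proof.
have -> : [set w | code n w = z] =
    \bigcap_(q in [set: 'I_M * 'I_N * 'I_n]) [set w | X q.1.1 q.1.2 q.2 w = z q].
  apply/seteqP; split => w /=; first by move=> <- q _; rewrite /= ffunE.
  by move=> h; apply/ffunP => q; rewrite ffunE; exact: h.
by apply: fin_bigcap_measurable => // ; exact: finite_finset.
Qed.

Lemma code_eq n w w' : code n w = code n w' ->
  forall i j k, (k < n)%N -> X i j k w = X i j k w'.
Proof.
move=> e i j k kn.
have := congr1 (fun f : {dffun forall q : 'I_M * 'I_N * 'I_n, 'I_(s q.1.1 q.1.2)} =>
   f (i, j, Ordinal kn)) e.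
by rewrite !ffunE.
Qed.

Lemma measurable_run n (F : history R M N -> R) :
  measurable_fun setT (fun w => F (run_at theta X alpha n w)).
Proof.
apply: (measurable_code (measurable_code_fiber (n := n))) => w w' e.
by congr (F _); apply: eq_run; exact: code_eq.
Qed.

End Runs.

Section Expectation.
Variables (R : realType) (M N : nat) (s : 'I_M -> 'I_N -> nat).
Variables (P : forall i j, 'M[R]_(s i j)) (stat : forall i j, 'rV[R]_(s i j)).
Variables (theta : forall i j, 'I_(s i j) -> R) (alpha : policy R M N).
Arguments theta : clear implicits.
Context (d : measure_display) (T : measurableType d) (Pr : probability T R).
Variable X : forall i j, nat -> T -> 'I_(s i j).
Hypothesis stoP : forall i j, stochastic (P i j).
Hypothesis irrP : forall i j, irreducible_chain (P i j).
Hypothesis statP : forall i j, stationary_distribution (P i j) (stat i j).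
Hypothesis restX : rested_chains P Pr X.
Variables (th L : R).
Hypothesis theta_th : forall i j z, 0 <= theta i j z <= th.
Hypothesis th0 : 0 < th.
Hypothesis s0 : forall i j, (0 < s i j)%N.
Hypothesis hL : forall i j, 90 * (th * (th * ((s i j)%:R / eigengap (P i j)))) <= L.

Let Xw w i j k := X i j k w.

(** Union bound over the [M N] pairs and the [t] possible play counts, each event having the tail at
    time [t.+1]. *)
Lemma bad_slot_prob t : (0 < t)%N ->
  measurable [set w | bad_slot stat theta (Xw w) L t] /\
  (Pr [set w | bad_slot stat theta (Xw w) L t] <=
    (M%:R * N%:R * (t%:R * (3 * (t.+1%:R ^+ 5)^-1)))%:E)%E.
Proof.
move=> t0.
pose A (q : 'I_M * 'I_N * 'I_t) :=
  [set w | Num.sqrt (L * ln t.+1%:R / q.2.+1%:R) <=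
    pair_dev stat theta (Xw w) q.1.1 q.1.2 q.2.+1].
have [mA PA] : (forall q, measurable (A q)) /\
    forall q, (Pr (A q) <= (3 * (t.+1%:R ^+ 5)^-1)%:E)%E.
  have h (q : 'I_M * 'I_N * 'I_t) := mean_tail
    (@stoP q.1.1 q.1.2) (proj1 (proj1 restX q.1.1 q.1.2))
    (proj2 (proj1 restX q.1.1 q.1.2)) (@irrP q.1.1 q.1.2) (@statP q.1.1 q.1.2)
    (@theta_th q.1.1 q.1.2) th0 (@s0 q.1.1 q.1.2) (@hL q.1.1 q.1.2) (ltn0Sn q.2)
    (t0 : (1 < t.+1)%N).
  by split => q; have [] := h q.
have -> : [set w | bad_slot stat theta (Xw w) L t] =
    \big[setU/set0]_(q <- index_enum _) A q.
  rewrite -bigcup_seq; apply/seteqP; split => w /=.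
    move=> /existsP[i /existsP[j /existsP[m h]]].
    by exists (i, j, m) => //=; exact: mem_index_enum.
  move=> [[[i j] m] _ h].
  by apply/existsP; exists i; apply/existsP; exists j; apply/existsP; exists m.
split; first exact: bigsetU_measurable.
apply: le_trans (Boole_seq _ _ mA) _.
apply: (@le_trans _ _ (\sum_(q : 'I_M * 'I_N * 'I_t) (3 * (t.+1%:R ^+ 5)^-1)%:E)%E).
  by apply: lee_sum => q _; exact: PA.
rewrite sumEFin lee_fin sumr_const !card_prod !card_ord -(mulr_natl (3 * _)).
by rewrite !natrM !mulrA.
Qed.

Lemma bad_slot_series n :
  \sum_(t < n | (0 < t)%N) t%:R * (3 * (t.+1%:R ^+ 5)^-1) <= 1 :> R.
Proof.
(* Telescoping majorant; the comparison amounts to [3 t ^ 2 <= (t + 1) ^ 4]. *)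
apply: (@le_trans _ _ (\sum_(t < n | (0 < t)%N) (t%:R^-1 - t.+1%:R^-1))).
  apply: ler_sum => t t0.
  have tR : (1 : R) <= t%:R by rewrite ler1n.
  rewrite -[t.+1%:R]natr1 -subr_ge0; move: (t%:R : R) tR => x x1.
  have -> : x^-1 - (x + 1)^-1 - x * (3 * (x + 1) ^- 5) =
    ((x + 1) ^+ 4 - 3 * x ^+ 2) / (x * (x + 1) ^+ 5).
    by field; rewrite !gt_eqF //; lra.
  rewrite divr_ge0 //; last by rewrite mulr_ge0 ?exprn_ge0 //; lra.
  nra.
case: n => [|n]; first by rewrite big_ord0.
rewrite big_mkcond big_ord_recl /= add0r.
have := telescope_sumr (fun k => - (k.+1%:R^-1 : R)) (leq0n n).
rewrite big_mkord => h.
under eq_bigr do rewrite /bump /= add1n addrC -[X in _ + X]opprK.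
rewrite h invr1 opprK addrC lerBlDr lerDl invr_ge0 //.
Qed.

Let mX i j k z : measurable [set w | X i j k w = z] :=
  proj1 (proj1 restX i j) k z.

Let mu_plays n a : \bar R :=
  (\int[Pr]_w ((arm_plays (run_at theta X alpha n w) a)%:R)%:E)%E.

(** Play counts are bounded by [n], hence integrable, and [fine] loses nothing. *)
Lemma expected_playsE n a : (expected_plays theta Pr X alpha n a)%:E = mu_plays n a.
Proof.
rewrite /expected_plays unlock fineK //.
apply: integrable_fin_num => //; apply: measurable_bounded_integrable => //.
- exact: le_lt_trans (probability_le1 Pr measurableT) (ltry 1).

- exact: (measurable_run theta alpha mX n (fun h => (arm_plays h a)%:R)).
exists n%:R; split; first exact: num_real.
move=> r nr w _ /=; rewrite ger0_norm ?ler0n // (le_trans _ (ltW nr)) //.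
by rewrite ler_nat -[leqRHS](size_run theta alpha (Xw w)) count_size.
Qed.

Lemma expected_plays_ge0 n a : 0 <= expected_plays theta Pr X alpha n a.
Proof.
by rewrite -lee_fin expected_playsE integral_ge0 // => w _; rewrite lee_fin ler0n.
Qed.

Variables (astar : arm M N) (Delta : R) (n : nat).
Hypothesis L0 : 0 < L.
Hypothesis mlmr : is_MLMR L alpha.
Hypothesis astarE : arm_mean stat theta astar = mu_star stat theta.
Hypothesis Delta0 : 0 < Delta.
Hypothesis gapD : forall a, arm_mean stat theta a < mu_star stat theta ->
  Delta <= gap stat theta a.

(** The pathwise count is integrated: the charged slots give the constant [C], and the probabilities
    of bad slots sum to at most [M N]. *)
Lemma expected_suboptimal_plays : (0 < M)%N -> (0 < N)%N ->
  \sum_(a | suboptimal stat theta a) expected_plays theta Pr X alpha n a <=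
  M%:R * N%:R * (4 * M%:R ^+ 2 * L * ln n%:R / Delta ^+ 2 + 1) + M%:R * N%:R.
Proof.
move=> M0 N0; set C := M%:R * N%:R * (_ + 1).
have C0 : 0 <= C.
  by rewrite !mulr_ge0 ?ler0n // addr_ge0 // threshold_ge0.
have MN0 : (0 < M * N)%N by rewrite muln_gt0 M0.
pose B t := [set w | (M * N <= t)%N && bad_slot stat theta (Xw w) L t].
have B0 t : (t < M * N)%N -> B t = set0.
  by rewrite /B ltnNge => /negPf ->; apply/seteqP; split.
have BE t : (M * N <= t)%N -> B t = [set w | bad_slot stat theta (Xw w) L t].
  by rewrite /B => ->.
have mB t : measurable (B t).
  have [MNt|/B0 ->] := leqP (M * N) t; last exact: measurable0.
  by rewrite BE //; have [] := bad_slot_prob (leq_trans MN0 MNt).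
have mplays a : measurable_fun setT
    (EFin \o (fun w => (arm_plays (run_at theta X alpha n w) a)%:R : R)).
  apply/measurable_EFinP.
  exact: (measurable_run theta alpha mX n (fun h => (arm_plays h a)%:R)).
have mind t : measurable_fun setT (EFin \o (\1_(B t) : T -> R)).
  by apply/measurable_EFinP; exact: measurable_indic.
rewrite -lee_fin -sumEFin.
under eq_bigr do rewrite expected_playsE.
rewrite -big_filter -ge0_integral_sum //.
apply: (@le_trans _ _ (\int[Pr]_w (C%:E + \sum_(t <- iota 0 n) (\1_(B t) w)%:E))%E).
  apply: ge0_le_integral => //.
  - by move=> w _; apply: sume_ge0 => a _; rewrite lee_fin ler0n.
  - by apply: emeasurable_sum.
  - by apply: emeasurable_funD => //; apply: emeasurable_sum.
  move=> w _; rewrite !sumEFin -EFinD lee_fin big_filter -natr_sum.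
  apply: le_trans (suboptimal_plays_le (Xw w) L0 mlmr n astarE Delta0 gapD M0) _.
  rewrite -/C lerD2l.
  have -> : iota 0 n = index_iota 0 n by rewrite /index_iota subn0.
  rewrite big_mkord big_mkcond /=; apply: ler_sum => t _.
  rewrite indicE; have [MNt|_] := leqP (M * N) t; last exact: ler0n.
  rewrite BE // ler_nat; case b: bad_slot => //.
  by rewrite mem_set.
rewrite ge0_integralD //=; last 2 first.
- by move=> w _; apply: sume_ge0 => t _; rewrite lee_fin.
- by apply: emeasurable_sum.
rewrite integral_cst // EFinD.
have -> : (C%:E * Pr setT = C%:E)%E.
  by apply: etrans (mule1 C%:E); congr (_ * _)%E; exact: probability_setT.
rewrite leeD2l //.
rewrite ge0_integral_sum //.
apply: (@le_trans _ _ (\sum_(t <- iota 0 n) ((if (0 < t)%N then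
    M%:R * N%:R * (t%:R * (3 * (t.+1%:R ^+ 5)^-1)) else 0)%:E))%E).
  apply: lee_sum => t _; rewrite integral_indic // setIT.
  have [MNt|/B0 ->] := leqP (M * N) t; last first.
    by rewrite measure0 lee_fin; case: ifP.
  have t0 := leq_trans MN0 MNt; rewrite t0 BE //.
  by have [] := bad_slot_prob t0.
rewrite sumEFin lee_fin.
have -> : iota 0 n = index_iota 0 n by rewrite /index_iota subn0.
rewrite big_mkord -big_mkcond /= -mulr_sumr -[leRHS]mulr1.
by rewrite ler_wpM2l ?mulr_ge0 ?ler0n // bad_slot_series.
Qed.

End Expectation.

(** * Regret of MLMR *)

Section Constants.
Variables (R : realType) (M N : nat) (s : 'I_M -> 'I_N -> nat).

Lemma pair_setE (F : 'I_M -> 'I_N -> R) :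
  [set r | exists i j, r = F i j] = (fun q => F q.1 q.2) @` setT.
Proof.
apply/seteqP; split => r /=; first by move=> [i0 [j ->]]; exists (i0, j).
by move=> [[i j] _ <-]; exists i, j.
Qed.

(** The type of states depends on the pair, so triples are packed into one finite sigma type on
    which extrema are attained. *)
Lemma triple_setE (F : forall i j, 'I_(s i j) -> R) :
  [set r | exists i j z, r = F i j z] =
  (fun u : {q : 'I_M * 'I_N & 'I_(s q.1 q.2)} => F _ _ (tagged u)) @` setT.
Proof.
apply/seteqP; split => r /=.
  move=> [i0 [j [z ->]]].
  by exists (Tagged (fun q => 'I_(s q.1 q.2)) (z : 'I_(s (i0, j).1 (i0, j).2))).
by move=> [[[i j] z] _ <-]; exists i, j, z.
Qed.

Variables (i0 : 'I_M) (j0 : 'I_N).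

Lemma pair_sup (F : 'I_M -> 'I_N -> R) i j : F i j <= sup [set r | exists i j, r = F i j].
Proof.
rewrite pair_setE.
by have [_ [_ _ /(_ (i, j) I)]] := finite_max (fun q => F q.1 q.2) (I : setT (i0, j0)).
Qed.

Lemma pair_inf (F : 'I_M -> 'I_N -> R) :
  exists i1 j1, inf [set r | exists i j, r = F i j] = F i1 j1 /\
  forall i j, F i1 j1 <= F i j.
Proof.
rewrite pair_setE.
have [[i1 j1] [_ -> h]] := finite_min (fun q => F q.1 q.2) (I : setT (i0, j0)).
by exists i1, j1; split => // i j; exact: (h (i, j)).
Qed.

Variable z0 : 'I_(s i0 j0).
Let u0 : {q : 'I_M * 'I_N & 'I_(s q.1 q.2)} :=
  Tagged (fun q => 'I_(s q.1 q.2)) (z0 : 'I_(s (i0, j0).1 (i0, j0).2)).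

Lemma triple_sup (F : forall i j, 'I_(s i j) -> R) i j z :
  F i j z <= sup [set r | exists i j z, r = F i j z].
Proof.
rewrite triple_setE.
have [_ [_ _ h]] := finite_max
  (fun u : {q : 'I_M * 'I_N & 'I_(s q.1 q.2)} => F _ _ (tagged u)) (I : setT u0).
exact: (h (Tagged (fun q => 'I_(s q.1 q.2)) (z : 'I_(s (i, j).1 (i, j).2))) I).
Qed.

Lemma triple_inf (F : forall i j, 'I_(s i j) -> R) :
  exists i1 j1 z1, inf [set r | exists i j z, r = F i j z] = F i1 j1 z1.
Proof.
rewrite triple_setE.
have [[[i1 j1] z1] [_ -> _]] := finite_min
  (fun u : {q : 'I_M * 'I_N & 'I_(s q.1 q.2)} => F _ _ (tagged u)) (I : setT u0).
by exists i1, j1, z1.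
Qed.

End Constants.

Theorem theorem1 (R : realType) (M N : nat) (s : 'I_M -> 'I_N -> nat)
    (P : forall i j, 'M[R]_(s i j)) (stat : forall i j, 'rV[R]_(s i j))
    (theta : forall i j, 'I_(s i j) -> R)
    (d : measure_display) (T : measurableType d) (Pr : probability T R)
    (X : forall i j, nat -> T -> 'I_(s i j))
    (L A : R) (alpha : policy R M N) (n : nat) :
  (0 < M)%N -> (M <= N)%N ->
  (forall i j, stochastic (P i j)) ->
  (forall i j, irreducible_chain (P i j)) ->
  (forall i j, aperiodic_chain (P i j)) ->
  (forall i j, stationary_distribution (P i j) (stat i j)) ->
  (forall i j z, 0 < theta i j z) ->
  rested_chains P Pr X ->
  regret_constant P stat theta A ->
  0 < L ->
  (50 + 40 * M%:R) * theta_max theta ^+ 2 * s_max R s ^+ 2 / eps_min P <= L ->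
  is_MLMR L alpha ->
  (1 <= n)%N ->
  regret stat theta Pr X alpha n <=
    (4 * M%:R ^+ 3 * N%:R * L * ln n%:R / gap_min stat theta ^+ 2
     + M%:R * N%:R
     + M%:R ^+ 2 * N%:R * (s_max R s / stat_min stat)
       * (1 + eps_max P * Num.sqrt L / (10 * s_min R s * theta_min theta))
       * (pi ^+ 2 / 3))
    * gap_max stat theta + A.
Proof.
move=> M0 MN stoP irrP _ statP theta0 restX regA L0 hL mlmr n0.
have N0 : (0 < N)%N by exact: leq_trans MN.
pose i0 := Ordinal M0; pose j0 := Ordinal N0.
have s0 i j : (0 < s i j)%N.
  rewrite lt0n; apply/eqP => s0; have [[_ + ] _] := statP i j.
  move: (stat i j); rewrite s0 => p; rewrite big_ord0 => /eqP.
  by rewrite eq_sym oner_eq0.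
pose z0 := Ordinal (s0 i0 j0).
have th_le i j z : theta i j z <= theta_max theta by exact: (triple_sup z0).
have th0 : 0 < theta_max theta by exact: lt_le_trans (theta0 _ _ z0) (th_le _ _ _).
have thmin0 : 0 < theta_min theta.
  by have [i [j [z e]]] := triple_inf z0 theta; rewrite /theta_min e.
have smax_ge i j : (s i j)%:R <= s_max R s.
  exact: (pair_sup i0 j0 (fun i j => (s i j)%:R)).
have smin0 : 0 <= s_min R s.
  have [i [j [e _]]] := pair_inf i0 j0 (fun i j => (s i j)%:R : R).
  by rewrite /s_min e ler0n.
have statm : 0 < stat_min stat <= 1.
  have [i [j [z e]]] := triple_inf z0 (fun i j z => stat i j 0 z).
  rewrite /stat_min e (stationary_gt0 (stoP i j) (irrP i j) (statP i j)) /=.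
  have [[p0 <-] _] := statP i j.
  by rewrite (bigD1 z) //= lerDl sumr_ge0.
have eps0 i j : 0 < eigengap (P i j).
  exact: eigengap_gt0 (stoP i j) (irrP i j) (statP i j).
have epsmax0 : 0 <= eps_max P.
  apply: le_trans (ltW (eps0 i0 j0)) _.
  exact: (pair_sup i0 j0 (fun i j => eigengap (P i j))).
have [epsm0 epsm_le] : 0 < eps_min P /\ forall i j, eps_min P <= eigengap (P i j).
  have [i [j [e h]]] := pair_inf i0 j0 (fun i j => eigengap (P i j)).
  by rewrite /eps_min e; split.
(* As [M >= 1], the factor [50 + 40 M] is at least 90; moreover [s i j <= s_max ^ 2], since all
   state spaces are nonempty. *)
have hLij i j :
    90 * (theta_max theta * (theta_max theta * ((s i j)%:R / eigengap (P i j)))) <= L.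
  apply: le_trans hL; rewrite ler_pdivlMr //.
  have s1 : (1 : R) <= (s i j)%:R by rewrite ler1n.
  have M1 : (1 : R) <= M%:R by rewrite ler1n.
  have sm := smax_ge i j; have el := epsm_le i j; have e0 := eps0 i j.
  have : (s i j)%:R / eigengap (P i j) * eps_min P <= s_max R s ^+ 2.
    apply: (@le_trans _ _ (s i j)%:R).
      by rewrite -mulrA ler_piMr ?ler0n // mulrC ler_pdivrMr // mul1r.
    by rewrite expr2; nra.
  have t2 : 0 < theta_max theta ^+ 2 by rewrite exprn_gt0.
  move=> h; apply: (@le_trans _ _ (90 * theta_max theta ^+ 2 * s_max R s ^+ 2)).
    move: h; set q := _ / _ => h.
    have := ler_wpM2l (ltW t2) h; rewrite expr2; lra.
  have := mulr_ge0 (ltW t2) (sqr_ge0 (s_max R s)); nra.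
have [astar [_ eS mean_le]] := finite_max (arm_mean stat theta) (I : setT (alpha [::])).
have gap0 a : 0 <= gap stat theta a by rewrite subr_ge0; exact: mean_le.
have gap_le a : gap stat theta a <= gap_max stat theta.
  by have [_ [_ _ h]] := finite_max (gap stat theta) (I : setT (alpha [::])); exact: h.
have gmax0 : 0 <= gap_max stat theta by exact: le_trans (gap0 astar) (gap_le astar).
set K := (_ + _ + _).
(* The expected number of plays carries [M N] twice, for the rounding of the counters and for the
   bad slots. The second copy is absorbed here, all remaining factors being at least 1. *)
have lastK : M%:R * N%:R <= M%:R ^+ 2 * N%:R * (s_max R s / stat_min stat)
       * (1 + eps_max P * Num.sqrt L / (10 * s_min R s * theta_min theta))
       * (pi ^+ 2 / 3).
  have a1 : 1 <= s_max R s / stat_min stat.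
    have /andP[p0 p1] := statm; rewrite ler_pdivlMr // mul1r (le_trans p1) //.
    by apply: le_trans (smax_ge i0 j0); rewrite ler1n.
  have a2 : 1 <= 1 + eps_max P * Num.sqrt L / (10 * s_min R s * theta_min theta).
    rewrite lerDl divr_ge0 ?mulr_ge0 ?sqrtr_ge0 //; exact: ltW.
  have a3 : 1 <= (pi : R) ^+ 2 / 3 by have := pi_ge2 R; nra.
  have a4 : M%:R * N%:R <= M%:R ^+ 2 * N%:R :> R.
    by rewrite ler_wpM2r ?ler0n // ler_eXnr // ler1n.
  have a5 : 0 <= M%:R ^+ 2 * N%:R :> R by rewrite mulr_ge0 ?exprn_ge0 ?ler0n.
  apply: (le_trans a4); rewrite -[leRHS]mulrA -[leRHS]mulrA ler_peMr //.
  exact: mulr_ege1 a1 (mulr_ege1 a2 a3).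
have lnn0 : 0 <= ln n%:R :> R by rewrite ln_ge0 // ler1n.
have MN_ge0 : 0 <= M%:R * N%:R :> R by rewrite mulr_ge0 ?ler0n.
have K0 : 0 <= K.
  apply: addr_ge0 (le_trans MN_ge0 lastK); apply: addr_ge0 MN_ge0.
  by rewrite divr_ge0 ?sqr_ge0 // !mulr_ge0 ?exprn_ge0 ?ler0n // ltW.
apply: le_trans (regA d T Pr X restX alpha n n0) _; rewrite lerD2r.
have gapE a : ~~ suboptimal stat theta a -> gap stat theta a = 0.
  rewrite -leNgt => h; apply/eqP; rewrite subr_eq0 eq_le h; exact: mean_le.
rewrite (bigID (suboptimal stat theta)) /= [X in _ + X]big1 ?addr0; last first.
  by move=> a /gapE ->; rewrite mul0r.
(* Without suboptimal arms [gap_min] is the infimum of an empty set, but the sum is empty as well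
   and the bracket is nonnegative. *)
have [a1 sub1|nosub] := pickP (suboptimal stat theta); last first.
  by rewrite big_pred0 // mulr_ge0.
have sub1' : [set a | arm_mean stat theta a < mu_star stat theta] a1 by exact: sub1.
have [a2 [sub2 gE g_le]] := finite_min (gap stat theta) sub1'.
have gmin0 : 0 < gap_min stat theta by rewrite /gap_min gE subr_gt0.
have theta_in i j z : 0 <= theta i j z <= theta_max theta.
  by rewrite th_le andbT ltW.
have bound := expected_suboptimal_plays stoP irrP statP restX theta_in
  th0 s0 hLij n L0 mlmr (esym eS) gmin0 g_le M0 N0.
apply: (@le_trans _ _ ((\sum_(a | suboptimal stat theta a)
    expected_plays theta Pr X alpha n a) * gap_max stat theta)).
  rewrite mulr_suml; apply: ler_sum => a _; rewrite mulrC ler_wpM2l //.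
  exact: expected_plays_ge0 restX n a.
rewrite ler_wpM2r // (le_trans bound) // lerD //.
by rewrite le_eqVlt; apply/orP; left; apply/eqP; field; rewrite gt_eqF.
Qed.
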